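(* Let $B$ be the block-diagonal skew-symmetric $n\times n$ matrix with $k$ diagonal blocks equal to $$\begin{bmatrix} 0&1&i&0\\ -1&0&0&i\\ -i&0&0&-1\\ 0&-i&1&0\end{bmatrix}$$ and $r=n-4k$ diagonal $1\times 1$ blocks $[\,0\,]$. Then the $\mathrm O(n)$-orbit of $B$ has codimension $4k^2+2kr+\binom r2$. The base locus of the squaring map $\mathbb P(\wedge^2\mathbb C^n)\dashrightarrow\mathbb P(\mathrm{Sym}^2\mathbb C^n)$, $X\mapsto X^2$, is the union of all such orbits. The base locus has two irreducible components if $n$ is a multiple of $4$, and it is irreducible otherwise.
   Context: $\mathbb P(\wedge^2\mathbb C^n)$ is the projective space of nonzero complex skew-symmetric $n\times n$ matrices up to scaling, and $\mathbb P(\mathrm{Sym}^2\mathbb C^n)$ is that of nonzero complex symmetric $n\times n$ matrices up to scaling. $\mathrm O(n)$ is the complex orthogonal group, acting on skew-symmetric matrices by conjugation $X\mapsto R^TXR$. Orbits are regarded as subsets of $\mathbb P(\wedge^2\mathbb C^n)$ (so $B$ is nonzero, i.e. $k\ge 1$), and codimension is taken in $\mathbb P(\wedge^2\mathbb C^n)$. The base locus of the squaring map is the set $\{X\in\mathbb P(\wedge^2\mathbb C^n): X^2=0\}$. *)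

(* Defs.v *)
From HB Require Import structures.
From mathcomp Require Import all_boot all_order all_algebra.
From mathcomp Require Import complex mpoly.
From mathcomp Require Import boolp classical_sets cardinality reals topology.

Set Implicit Arguments.
Unset Strict Implicit.
Unset Printing Implicit Defensive.

Import Order.TTheory GRing.Theory Num.Theory.

Local Open Scope classical_set_scope.
Local Open Scope ring_scope.

Section Irreducibility.
Context {T : topologicalType}.
Implicit Types A Z F G : set T.

(* The empty set is not irreducible. *)
Definition irreducible A :=
  A !=set0 /\
  forall F G, closed F -> closed G -> A `<=` F `|` G -> A `<=` F \/ A `<=` G.

Definition irreducible_component A Z :=
  [/\ irreducible Z, Z `<=` A &
      forall Z', irreducible Z' -> Z' `<=` A -> Z `<=` Z' -> Z' = Z].

Definition closed_in A Z := exists2 F, closed F & Z = A `&` F.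

(* Y 0 < ... < Y d are irreducible closed subsets of the subspace A. *)
Definition irreducible_chain A (d : nat) (Y : nat -> set T) :=
  (forall i, (i <= d)%N -> irreducible (Y i) /\ closed_in A (Y i)) /\
  (forall i, (i < d)%N -> Y i `<` Y i.+1).

(* The Krull dimension of the subspace A is d. *)
Definition krull_dim A (d : nat) :=
  (exists Y, irreducible_chain A d Y) /\
  (forall e Y, irreducible_chain A e Y -> (e <= d)%N).

Definition codimension A (c : nat) :=
  exists2 d : nat, krull_dim A d & krull_dim [set: T] (d + c)%N.

End Irreducibility.

(* The projective space P(V), as the set of lines of V. *)
Definition projspace (K : fieldType) (V : vectType K) : Type :=
  {L : {vspace V} | \dim L == 1%N}.

HB.instance Definition _ (K : fieldType) (V : vectType K) :=
  Choice.on (projspace V).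

Section ZariskiTopology.
Context {K : fieldType} {V : vectType K}.

Definition coords (v : V) : 'I_(\dim {:V}) -> K :=
  fun i => coord (vbasis {:V}) i v.

Definition vanishes (p : {mpoly K[\dim {:V}]}) (L : projspace V) :=
  forall v, v \in val L -> p.@[coords v] = 0.

Definition homogeneous (p : {mpoly K[\dim {:V}]}) :=
  exists d : nat, p \is d.-homog.

Definition zero_locus (S : set {mpoly K[\dim {:V}]}) : set (projspace V) :=
  [set L | forall p, S p -> vanishes p L].

Definition zariski_closed (A : set (projspace V)) :=
  exists2 S, S `<=` homogeneous & A = zero_locus S.

Definition zariski_open (A : set (projspace V)) := zariski_closed (~` A).

Lemma projspace_gen (L : projspace V) :
  exists2 v : V, v != 0 & val L = <[v]>%VS.
Proof.
have /eqP dL := valP L.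
have v0 : vpick (val L) != 0 by rewrite vpick0 -dimv_eq0 dL.
exists (vpick (val L)) => //; apply/esym/eqP.
by rewrite eqEdim -memvE memv_pick dL dim_vline v0.
Qed.

Lemma coordsZ a (v : V) : coords (a *: v) = (fun i => a * coords v i).
Proof. by apply/funext => i; rewrite /coords linearZ. Qed.

Lemma meval_homog d (p : {mpoly K[\dim {:V}]}) a (v : V) : p \is d.-homog ->
  p.@[coords (a *: v)] = a ^+ d * p.@[coords v].
Proof.
move=> hp; rewrite coordsZ !mevalE mulr_sumr big_seq [RHS]big_seq.
apply: eq_bigr => m mp.
rewrite mulrCA; congr (_ * _).
rewrite -(dhomogP _ _ _ hp _ mp) /= mdegE -prodrXr -big_split /=.
by apply: eq_bigr => i _; rewrite exprMn.
Qed.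

Lemma vanishesP d (p : {mpoly K[\dim {:V}]}) (L : projspace V) (v : V) :
  p \is d.-homog -> val L = <[v]>%VS -> vanishes p L <-> p.@[coords v] = 0.
Proof.
move=> hp Lv; split=> [|pv w]; first by apply; rewrite Lv memv_line.
by rewrite Lv => /vlineP[a ->]; rewrite (meval_homog _ _ hp) pv mulr0.
Qed.

Lemma zariski_openT : zariski_open setT.
Proof.
exists [set 1]; first by move=> p ->; exists 0%N; exact: dhomog1.
rewrite setCT; apply/esym/seteqP; split=> // L h.
have [v v0 Lv] := projspace_gen L.
have := h 1 erefl v; rewrite Lv memv_line meval1 => /(_ isT)/eqP.
by rewrite oner_eq0.
Qed.

Lemma zariski_openI A B :
  zariski_open A -> zariski_open B -> zariski_open (A `&` B).
Proof.
move=> [S hS eS] [U hU eU]; rewrite /zariski_open setCI eS eU.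
exists [set r | exists p q, [/\ S p, U q & r = p * q]].
  move=> r [p [q [/hS[d hp] /hU[e hq] ->]]].
  by exists (d + e)%N; exact: dhomogM.
apply/seteqP; split=> L.
  by move=> [h|h] _ [p [q [Sp Uq ->]]] v vL;
    rewrite mevalM ?(h _ Sp v vL) ?(h _ Uq v vL) ?mul0r ?mulr0.
move=> h; have [//|nS] := pselect (zero_locus S L); [by left|right].
move=> q Uq; have [e hq] := hU _ Uq.
have [v v0 Lv] := projspace_gen L.
apply/(vanishesP hq Lv); apply/eqP/negPn/negP => qv.
apply: nS => p Sp; have [d hp] := hS _ Sp.
apply/(vanishesP hp Lv).
have := h (p * q); move=> /(_ (ex_intro _ p (ex_intro _ q (And3 Sp Uq erefl)))) /(_ v).
by rewrite Lv memv_line mevalM => /(_ isT) /eqP; rewrite mulf_eq0 (negbTE qv) orbF => /eqP.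
Qed.

Lemma zariski_open_bigU (I : Type) (f : I -> set (projspace V)) :
  (forall i, zariski_open (f i)) -> zariski_open (\bigcup_i f i).
Proof.
move=> fo; exists [set p | homogeneous p /\
    forall L, (~` \bigcup_i f i) L -> vanishes p L].
  by move=> p [].
apply/seteqP; split=> [L hL p [_]|L h]; first exact.
move=> [i _ fiL]; have [S hS eS] := fo i.
suff : (~` f i) L by [].
rewrite eS => p Sp; apply: h; split; first exact: hS.
move=> M hM; suff : zero_locus S M by apply.
by rewrite -eS => fM; apply: hM; exists i.
Qed.

HB.instance Definition _ := isOpenTopological.Build (projspace V)
  zariski_openT zariski_openI zariski_open_bigU.

Lemma closed_zariskiE (A : set (projspace V)) : closed A <-> zariski_closed A.
Proof. by rewrite -openC /open /= /zariski_open setCK. Qed.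

End ZariskiTopology.

Section SkewSymmetric.
Context {R : realType}.
Local Notation C := R[i].
Variable n : nat.

Definition skewv : {vspace 'M[C]_n} :=
  lker (linfun (fun X : 'M[C]_n => X^T + X)).

Lemma skewvP (X : 'M[C]_n) : reflect (X^T = - X) (X \in skewv).
Proof.
rewrite memv_ker; have -> : linfun (fun X : 'M[C]_n => X^T + X) X = X^T + X.
  pose f : 'M[C]_n -> 'M[C]_n := (@trmx C n n \+ idfun)%R.
  exact: (lfunE f X).
by rewrite addr_eq0; exact: eqP.
Qed.

Definition skewmx : vectType C := subvs_of skewv.

Definition orthogonal (Q : 'M[C]_n) := Q^T *m Q = 1%:M.

Definition block4 : 'M[C]_4 :=
  \matrix_(i < 4, j < 4) nth 0 (nth [::]
    [:: [::    0;    1;  'i;    0 ];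
        [::   -1;    0;   0;   'i ];
        [:: - 'i;    0;   0;   -1 ];
        [::    0; - 'i;   1;    0 ]] i) j.

(* The block-diagonal matrix with k blocks block4 followed by zeros. *)
Definition Bmx (k : nat) : 'M[C]_n :=
  \matrix_(i < n, j < n)
    if (i < 4 * k)%N && (i %/ 4 == j %/ 4)%N
    then block4 (inord (i %% 4)) (inord (j %% 4)) else 0.

(* The orbit, in P(skewmx), of the point spanned by the matrix M. *)
Definition orbit_of (M : 'M[C]_n) : set (projspace skewmx) :=
  [set L : projspace skewmx | exists Q (X : skewmx),
     [/\ orthogonal Q, vsval X = Q^T *m M *m Q & val L = <[X]>%VS]].

Definition base_locus : set (projspace skewmx) :=
  [set L : projspace skewmx | forall X : skewmx, X \in val L -> vsval X *m vsval X = 0].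

End SkewSymmetric.
Arguments Bmx R n k : clear implicits.
Arguments base_locus R n : clear implicits.

(* Main.v *)
Require Import Defs.
From HB Require Import structures.
From mathcomp Require Import all_boot all_order all_algebra.
From mathcomp Require Import perm complex mpoly ring zify.
From mathcomp Require Import boolp classical_sets cardinality reals topology.

Set Implicit Arguments.
Unset Strict Implicit.
Unset Printing Implicit Defensive.

Import Order.TTheory GRing.Theory Num.Theory.

Local Open Scope classical_set_scope.
Local Open Scope card_scope.
Local Open Scope ring_scope.

(** A square-zero skew-symmetric matrix of rank [w] is a nondegenerate skew form
    [S] on an isotropic subspace of dimension [w]: it is [F^T *m S *m F] for a
    [w]-row matrix [F] with [F *m F^T = 0] ([sqr0_stratum]). Nondegenerate skew
    forms exist in even dimension only and are all congruent
    ([skew_normal_form]), and isotropic frames of the same size are exchanged by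
    products of reflections ([witt_isotropic]). Hence the square-zero matrices of
    rank [w] are a single orbit, and since [Bmx R n k] is one of those of rank
    [2 * k] ([Bmx_stratum]), the base locus is the union of the orbits.

    The dimension of an orbit is read off a chart. Near a point the isotropic
    subspace is a graph, given by a skew matrix [s] and a rectangular matrix [c]
    ([chart_frame]); together with the form, scaled to have one entry equal to 1,
    this makes ['C(w, 2).-1 + 'C(w, 2) + w * r] free parameters. Two theorems turn
    such a chart with [m] parameters into the Krull dimension [m]. The flag of
    coordinate subspaces gives a chain of length [m] ([chart_chain]). Conversely a
    chain of irreducible closed sets [Y 0, ..., Y e] yields forms [f i] of a common
    degree, vanishing on [Y i.-1] and not on [Y i], which satisfy no algebraic
    relation on [Y e]; the number of their monomials grows like [T ^ e] with the
    degree, while there are only [O(T ^ m)] linearly independent polynomials in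
    the [m] parameters, so that [e <= m] ([chain_length_le]). Both apply to the
    whole projective space as well ([krull_dim_projspace]).

    Irreducibility comes from parametrizations by vector spaces. Take a maximal
    isotropic frame [E] of even size. The matrices [F^T *m S *m F], where [S] is
    skew and [F] is the image of [E] under [N] reflections, depend polynomially on
    [S] and on the [N] vectors of the reflections, so they form an irreducible set
    ([frame_points]). When 4 does not divide [n] there is a reflection fixing [E],
    the parity of [N] is immaterial and one such set is the base locus. When 4
    divides [n], the base locus is the union of an even and an odd set. For an
    isotropic frame of size [n / 2] the left and right maximal minors agree up to
    sign, a reflection changes that sign, and a form in the entries of the matrix
    detects it ([sign_form]): neither set is in the closure of the other. *)

(** * Closures of irreducible sets *)

Lemma closure_closed_sub (T : topologicalType) (Z F : set T) :
  closed F -> Z `<=` F -> closure Z `<=` F.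
Proof. by move=> /closure_id FE ZF; rewrite FE; exact: closure_subset. Qed.

Lemma irreducible_closure_in (T : topologicalType) (A Z : set T) :
  irreducible Z -> Z `<=` A ->
  irreducible (A `&` closure Z) /\ closed_in A (A `&` closure Z).
Proof.
move=> [[x Zx] irr] ZA; split; last by exists (closure Z) => //; exact: closed_closure.
have sub : Z `<=` A `&` closure Z.
  by move=> y Zy; split; [exact: ZA|exact: subset_closure].
split; first by exists x; exact: sub.
move=> F G cF cG h.
have [y /sub /h //|ZF|ZG] := irr F G cF cG; [left|right] => y [_];
  exact: closure_closed_sub.
Qed.

Lemma card_set2 (T : Type) (a b : T) : a <> b -> [set a; b] #= `I_2.
Proof.
move=> ab; apply/card_set_bijP; exists (fun z => if `[< z = a >] then 0%N else 1%N).
split.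
- by move=> z _ /=; case: asboolP.
- move=> x y; rewrite !inE => hx hy.
  case: asboolP hx => [->|xa] hx; case: asboolP hy => [->|ya] hy //= _.
  by case: hx => // ->; case: hy => // ->.
- move=> [|[|i]] // _.
    by exists a; [left|case: asboolP].
  by exists b; [right|case: asboolP => // /esym].
Qed.

(** The closed sets [F0] and [F1] witness that neither of [Z0] and [Z1] lies in the
    closure of the other. *)
Lemma two_components (T : topologicalType) (A Z0 Z1 F0 F1 : set T) :
  irreducible Z0 -> irreducible Z1 -> A = Z0 `|` Z1 -> closed F0 -> closed F1 ->
  Z0 `<=` F0 -> Z1 `<=` F1 -> ~ Z0 `<=` F1 -> ~ Z1 `<=` F0 ->
  [set Z | irreducible_component A Z] #= `I_2.
Proof.
move=> i0 i1 AE c0 c1 s0 s1 n0 n1.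
pose C0 := A `&` closure Z0; pose C1 := A `&` closure Z1.
have Z0A : Z0 `<=` A by rewrite AE; exact: subsetUl.
have Z1A : Z1 `<=` A by rewrite AE; exact: subsetUr.
have Z0C : Z0 `<=` C0 by move=> x Zx; split; [exact: Z0A|exact: subset_closure].
have Z1C : Z1 `<=` C1 by move=> x Zx; split; [exact: Z1A|exact: subset_closure].
have C0F : C0 `<=` F0 by move=> x [_]; exact: closure_closed_sub.
have C1F : C1 `<=` F1 by move=> x [_]; exact: closure_closed_sub.
have sub Z : irreducible Z -> Z `<=` A -> Z `<=` C0 \/ Z `<=` C1.
  move=> [_ irr] ZA.
  have [x Zx|h|h] := irr (closure Z0) (closure Z1) (@closed_closure _ _) (@closed_closure _ _).
  - by have := ZA x Zx; rewrite {1}AE => -[]; [left|right]; exact: subset_closure.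
  - by left=> x Zx; split; [exact: ZA|exact: h].
  - by right=> x Zx; split; [exact: ZA|exact: h].
have iC0 : irreducible C0 by have [] := irreducible_closure_in i0 Z0A.
have iC1 : irreducible C1 by have [] := irreducible_closure_in i1 Z1A.
have CA0 : C0 `<=` A by exact: subIsetl.
have CA1 : C1 `<=` A by exact: subIsetl.
have -> : [set Z | irreducible_component A Z] = [set C0; C1].
  apply/seteqP; split=> [Z [iZ ZA maxZ]|Z].
    by have [h|h] := sub Z iZ ZA; [left|right]; apply/esym/maxZ.
  case=> ->; split=> // Z' iZ' ZA' h; apply/seteqP; split=> //.
    have [//|h'] := sub Z' iZ' ZA'.
    by case: n0; apply: subset_trans Z0C _; apply: subset_trans h _; apply: subset_trans h' _.
  have [h'|//] := sub Z' iZ' ZA'.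
  by case: n1; apply: subset_trans Z1C _; apply: subset_trans h _; apply: subset_trans h' _.
apply: card_set2 => CC; apply: n0; apply: subset_trans Z0C _.
by rewrite CC.
Qed.

(** * Homogeneous forms *)

Section Forms.
Context {K : fieldType} {V : vectType K}.
Implicit Types (f g : V -> K) (L : projspace V) (Y : set (projspace V)).

Definition hform d f :=
  exists2 p : {mpoly K[\dim {:V}]}, p \is d.-homog & forall v, f v = p.@[coords v].

Definition zeros f : set (projspace V) :=
  [set L : projspace V | forall v, v \in val L -> f v = 0].

Lemma hform_eq d f g : f =1 g -> hform d f -> hform d g.
Proof. by move=> fg [p hp e]; exists p => // v; rewrite -fg. Qed.

Lemma hform0 d : hform d (fun=> 0).
Proof. by exists 0; [exact: dhomog0 | move=> v; rewrite meval0]. Qed.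

Lemma hformD d f g : hform d f -> hform d g -> hform d (fun v => f v + g v).
Proof.
move=> [p hp ep] [q hq eq]; exists (p + q); first exact: dhomogD.
by move=> v; rewrite mevalD ep eq.
Qed.

Lemma hformM d e f g :
  hform d f -> hform e g -> hform (d + e) (fun v => f v * g v).
Proof.
move=> [p hp ep] [q hq eq]; exists (p * q); first exact: dhomogM.
by move=> v; rewrite mevalM ep eq.
Qed.

Lemma hform_const c : hform 0 (fun=> c).
Proof.
exists (c *: 1); first exact/dhomogZ/dhomog1.
by move=> v; rewrite mevalZ meval1 mulr1.
Qed.

Lemma hformZ d c f : hform d f -> hform d (fun v => c * f v).
Proof. exact: hformM (hform_const c). Qed.

Lemma hform_sum d (I : Type) (r : seq I) (F : I -> V -> K) :
  (forall i, hform d (F i)) -> hform d (fun v => \sum_(i <- r) F i v).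
Proof.
move=> hF; elim: r => [|i r IH].
  by apply: hform_eq (hform0 d) => v; rewrite big_nil.
by apply: hform_eq (hformD (hF i) IH) => v; rewrite big_cons.
Qed.

Lemma hformX d k f : hform d f -> hform (d * k) (fun v => f v ^+ k).
Proof.
move=> hf; elim: k => [|k IH]; first by rewrite muln0; exact: hform_const.
by rewrite mulnS; apply: hform_eq (hformM hf IH) => v; rewrite exprS.
Qed.

Lemma hform_lin (l : V -> K) : scalar l -> hform 1 l.
Proof.
move=> hl.
have l0 : l 0 = 0 by have := hl (-1) 0 0; rewrite scaler0 addr0 mulN1r addNr.
have lD u v : l (u + v) = l u + l v by have := hl 1 u v; rewrite scale1r mul1r.
have lZ a u : l (a *: u) = a * l u by have := hl a u 0; rewrite l0 !addr0.
exists (\sum_(i < \dim {:V}) l (vbasis {:V})`_i *: 'X_i).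
  apply: rpred_sum => i _; apply: dhomogZ; rewrite dhomogX; apply/eqP; exact: mdeg1.
move=> v; rewrite {1}(coord_vbasis (memvf v)) (big_morph _ lD l0).
rewrite (big_morph (meval _) (mevalD _) (meval0 _)).
by apply: eq_bigr => i _; rewrite mevalZ mevalXU lZ mulrC.
Qed.

Lemma hform_scale d f a v : hform d f -> f (a *: v) = a ^+ d * f v.
Proof. by move=> [p hp e]; rewrite !e (meval_homog _ _ hp). Qed.

Lemma zerosP d f L v : hform d f -> val L = <[v]>%VS -> zeros f L <-> f v = 0.
Proof.
move=> hf Lv; split=> [|fv w]; first by apply; rewrite Lv memv_line.
by rewrite Lv => /vlineP[a ->]; rewrite (hform_scale _ _ hf) fv mulr0.
Qed.

Lemma closed_zeros d f : hform d f -> closed (zeros f).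
Proof.
move=> [p hp e]; apply/closed_zariskiE; exists [set p].
  by move=> _ ->; exists d.
apply/seteqP; split=> [L h q -> v Lv|L h v Lv]; first by rewrite -e h.
by rewrite e; apply: h.
Qed.

(** The zero loci of forms are a basis of closed sets. *)
Lemma closed_separation (F : set (projspace V)) L : closed F -> ~ F L ->
  exists d f, [/\ hform d f, F `<=` zeros f & ~ zeros f L].
Proof.
move=> /closed_zariskiE[S hS ->] nL; apply: contrapT => h; apply: nL => p Sp.
have [d hp] := hS _ Sp; apply: contrapT => nv; apply: h.
exists d, (fun v => p.@[coords v]); split; first by exists p.
- by move=> M hM v Mv; apply: hM.
- exact: nv.
Qed.

Lemma projspace_point (v : V) : v != 0 -> exists L : projspace V, val L = <[v]>%VS.
Proof. by move=> v0; exists (exist _ <[v]>%VS (introT eqP (etrans (dim_vline v) (congr1 nat_of_bool v0)))). Qed.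

Lemma span_neq0 L v : val L = <[v]>%VS -> v != 0.
Proof.
move=> Lv; apply/eqP => v0; have := valP L; rewrite Lv v0 /=.
by rewrite dim_vline eqxx.
Qed.

Lemma coords_scalar i : scalar (fun v : V => coords v i).
Proof. by move=> a u v; rewrite /coords linearP. Qed.

Lemma exists_coord (v : V) : v != 0 -> exists i, coords v i != 0.
Proof.
move=> v0; apply/existsP; apply: contraNT v0; rewrite negb_exists => /forallP h.
rewrite (coord_vbasis (memvf v)) big1 // => i _.
by have := h i; rewrite negbK => /eqP; rewrite /coords => ->; rewrite scale0r.
Qed.

Lemma irreducible_zerosM d e f g Y : hform d f -> hform e g -> irreducible Y ->
  Y `<=` zeros (fun v => f v * g v) -> Y `<=` zeros f \/ Y `<=` zeros g.
Proof.
move=> hf hg [_ irr] YY; apply: irr; [exact: closed_zeros hf|exact: closed_zeros hg|].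
move=> L /YY h; have [v v0 Lv] := projspace_gen L.
have := (zerosP (hformM hf hg) Lv).1 h => /eqP; rewrite mulf_eq0.
by case/orP=> /eqP fv; [left; apply/(zerosP hf Lv)|right; apply/(zerosP hg Lv)].
Qed.

End Forms.

(** * Polynomial maps *)

Section LinePolynomials.
Context {K : fieldType} {U : lmodType K}.
Implicit Types f g : U -> K.

(** Polynomials of degree at most [E], seen through their restrictions to lines.
    Lines suffice to exploit polynomiality: they connect the points of a
    parameter space, and those along the axes propagate zeros from a grid. *)
Definition line_poly E f := forall u v : U,
  exists2 P : {poly K}, (size P <= E.+1)%N & forall t, f (u + t *: v) = P.[t].

Lemma line_poly_eq E f g : f =1 g -> line_poly E f -> line_poly E g.
Proof.
by move=> fg h u v; have [P sP e] := h u v; exists P => // t; rewrite -fg.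
Qed.

Lemma line_poly_le E E' f : (E <= E')%N -> line_poly E f -> line_poly E' f.
Proof.
move=> le h u v; have [P sP e] := h u v; exists P => //.
by apply: leq_trans sP _.
Qed.

Lemma line_poly_const E c : line_poly E (fun=> c).
Proof.
move=> u v; exists c%:P; last by move=> t; rewrite hornerC.
by rewrite (leq_trans (size_polyC_leq1 _)).
Qed.

Lemma line_polyD E f g :
  line_poly E f -> line_poly E g -> line_poly E (fun u => f u + g u).
Proof.
move=> hf hg u v; have [P sP e] := hf u v; have [Q sQ e'] := hg u v.
exists (P + Q); last by move=> t; rewrite e e' hornerD.
by rewrite (leq_trans (size_polyD _ _)) // geq_max sP sQ.
Qed.

Lemma line_polyM E E' f g :
  line_poly E f -> line_poly E' g -> line_poly (E + E') (fun u => f u * g u).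
Proof.
move=> hf hg u v; have [P sP e] := hf u v; have [Q sQ e'] := hg u v.
exists (P * Q); last by move=> t; rewrite e e' hornerM.
rewrite (leq_trans (size_polyMleq _ _)) //; lia.
Qed.

Lemma line_poly_sum E (I : Type) (r : seq I) (F : I -> U -> K) :
  (forall i, line_poly E (F i)) -> line_poly E (fun v => \sum_(i <- r) F i v).
Proof.
move=> hF; elim: r => [|i r IH].
  by apply: line_poly_eq (line_poly_const E 0) => v; rewrite big_nil.
by apply: line_poly_eq (line_polyD (hF i) IH) => v; rewrite big_cons.
Qed.

Lemma line_polyX E k f : line_poly E f -> line_poly (E * k) (fun u => f u ^+ k).
Proof.
move=> hf; elim: k => [|k IH].
  by apply: line_poly_eq (line_poly_const _ 1) => v; rewrite expr0.
by rewrite mulnS; apply: line_poly_eq (line_polyM hf IH) => v; rewrite exprS.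
Qed.

Lemma line_poly_lin (l : U -> K) : scalar l -> line_poly 1 l.
Proof.
move=> hl u v; exists ((l u)%:P + l v *: 'X).
  rewrite (leq_trans (size_polyD _ _)) // geq_max.
  rewrite (leq_trans (size_polyC_leq1 _)) //=.
  by rewrite (leq_trans (size_scale_leq _ _)) // size_polyX.
by move=> t; rewrite addrC hl hornerD hornerC hornerZ hornerX addrC mulrC.
Qed.

Definition poly_map {V : vectType K} D (psi : U -> V) :=
  forall i, line_poly D (fun u => coords (psi u) i).

Lemma line_poly_form {V : vectType K} D d (psi : U -> V) (f : V -> K) :
  poly_map D psi -> hform d f -> line_poly (D * d) (f \o psi).
Proof.
move=> hpsi [p hp e].
have mono (m : 'X_{1..\dim {:V}}) :
    line_poly (D * mdeg m) (fun u => \prod_i coords (psi u) i ^+ m i).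
  rewrite mdegE; elim: (index_enum _) => [|i r IH].
    by apply: line_poly_eq (line_poly_const _ 1) => v; rewrite big_nil.
  rewrite big_cons mulnDr.
  by apply: line_poly_eq (line_polyM (line_polyX (m i) (hpsi i)) IH) => v; rewrite big_cons.
apply: (@line_poly_eq _ (fun u => \sum_(m <- msupp p) (if m \in msupp p then
    p@_m * \prod_i coords (psi u) i ^+ m i else 0))).
  move=> u /=; rewrite e mevalE [RHS]big_seq [LHS]big_seq.
  by apply: eq_bigr => m mp; rewrite mp.
apply: line_poly_sum => m; have [mp|_] := boolP (m \in msupp p); last exact: line_poly_const.
have md : mdeg m = d by move/dhomogP: hp => /(_ m mp).
rewrite -md.
exact: line_polyM (line_poly_const 0 _) (mono m).
Qed.

End LinePolynomials.

(** * The dimension of chains of irreducible closed sets *)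

Section Dimension.
Context {K : numFieldType} {V : vectType K}.
Implicit Types (Y A : set (projspace V)).

Lemma many_roots_eq0 E (P : {poly K}) : (size P <= E.+1)%N ->
  (forall a, (a <= E)%N -> P.[a%:R] = 0) -> P = 0.
Proof.
move=> sP h; apply: contraTeq sP => P0; rewrite -ltnNge.
have -> : E.+1 = size [seq (a%:R : K) | a <- iota 0 E.+1] by rewrite size_map size_iota.
apply: max_poly_roots => //.
  apply/allP => x /mapP[a]; rewrite mem_iota add0n ltnS => /andP[_ aE] ->.
  by rewrite /root h.
by rewrite map_inj_uniq ?iota_uniq //; apply: mulrIn; rewrite oner_eq0.
Qed.

(** By induction on the number of coordinates that are not on the grid. *)
Lemma grid_zero m E (f : 'rV[K]_m -> K) : line_poly E f ->
  (forall a : 'I_m -> 'I_E.+1, f (\row_i (a i)%:R) = 0) -> forall x, f x = 0.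
Proof.
move=> hf h.
suff H : forall j (x : 'rV[K]_m), (forall i : 'I_m, (j <= i)%N -> exists a : 'I_E.+1, x 0 i = a%:R) -> f x = 0.
  by move=> x; apply: (H m) => i; rewrite leqNgt ltn_ord.
elim=> [|j IH] x hx.
  have [a ha] := choice (fun i => hx i (leq0n i)).
  by rewrite -(h a); congr f; apply/rowP => i; rewrite mxE ha.
have [jm|mj] := ltnP j m; last first.
  by apply: IH => i; rewrite leqNgt (leq_trans (ltn_ord i) mj).
pose i0 := Ordinal jm; pose y := x - x 0 i0 *: delta_mx 0 i0.
have [P sP e] := hf y (delta_mx 0 i0).
have P0 : P = 0.
  apply: many_roots_eq0 sP _ => a aE; rewrite -e; apply: IH => i; rewrite leq_eqVlt.
  case/orP=> [/eqP ji|ji].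
    exists (Ordinal (aE : (a < E.+1)%N)).
    have -> : i = i0 by apply: val_inj.
    by rewrite /y !mxE !eqxx mulr1 subrr add0r mulr1.
  have [b xb] := hx i ji; exists b; rewrite /y !mxE eqxx /=.
  have /negbTE -> : i != i0 by apply: contraTneq ji => ->; rewrite ltnn.
  by rewrite !mulr0 subr0 addr0.
by have := e (x 0 i0); rewrite subrK P0 horner0.
Qed.

Definition independent_on Y (I : finType) (p : I -> V -> K) := forall c : I -> K,
  Y `<=` zeros (fun v => \sum_i c i * p i v) -> forall i, c i = 0.

(** Forms of degree [d] on an [m]-parameter family of points become polynomials
    of degree at most [D * d] in each parameter, and those are determined by
    their values on a grid. *)
Lemma independent_card_le Y m D d (psi : 'rV[K]_m -> V) (I : finType) (p : I -> V -> K) :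
  poly_map D psi -> (forall i, hform d (p i)) ->
  (forall L, Y L -> exists x, val L = <[psi x]>%VS) ->
  independent_on Y p -> (#|I| <= (D * d).+1 ^ m)%N.
Proof.
move=> hpsi hp par ind; rewrite leqNgt; apply/negP => lt.
pose G := {ffun 'I_m -> 'I_(D * d).+1}.
pose M : 'M[K]_(#|I|, #|G|) := \matrix_(i, j)
  p (enum_val i) (psi (\row_k ((enum_val j : G) k)%:R)).
have cG : #|G| = ((D * d).+1 ^ m)%N by rewrite card_ffun !card_ord.
have : kermx M != 0.
  rewrite kermx_eq0 -row_leq_rank -ltnNge.
  by rewrite (leq_ltn_trans (rank_leq_col M)) // cG.
case/rowV0Pn => c /sub_kermxP cM c0.
case/negP: c0; apply/eqP/rowP => i; rewrite [RHS]mxE.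
rewrite -(enum_valK i); move: (enum_val i) => {}i.
pose f v := \sum_i c 0 (enum_rank i) * p i v.
have hf : hform d f by apply: hform_sum => j; exact: hformZ.
apply: (ind (fun i => c 0 (enum_rank i))) => L /par[x Lx].
apply/(zerosP hf Lx); apply: (grid_zero (line_poly_form hpsi hf)) => a /=.
have := congr1 (fun B : 'rV_#|G| => B 0 (enum_rank (finfun a))) cM; rewrite !mxE.
rewrite /f (reindex_onto enum_rank enum_val) /=; last by move=> j _; exact: enum_valK.
under eq_bigl do rewrite enum_rankK eqxx.
move=> e; apply: etrans e; apply: eq_bigr => j _; rewrite mxE !enum_rankK.
by congr (_ * p _ (psi _)); apply/rowP => k; rewrite !mxE ffunE.
Qed.

(** If the form [f i.+1] vanishes on [Y i] but not on [Y i.+1], then [f 0, ..., f e]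
    behave like algebraically independent elements: in a relation between
    monomials on [Y i.+1] one may cancel [f i.+1] and restrict to [Y i]. *)
Lemma chain_independent e (Y : nat -> set (projspace V)) (f : nat -> V -> K) delta :
  (forall i, (i <= e)%N -> irreducible (Y i)) ->
  (forall i, (i <= e)%N -> hform delta (f i)) ->
  (forall i, (i <= e)%N -> ~ Y i `<=` zeros (f i)) ->
  (forall i, (i < e)%N -> Y i `<=` Y i.+1 /\ Y i `<=` zeros (f i.+1)) ->
  forall T i B, (i <= e)%N -> (i * T <= B)%N ->
  exists (I : finType) (p : I -> V -> K),
   [/\ #|I| = (T ^ i)%N, forall s, hform (delta * B) (p s) & independent_on (Y i) p].
Proof.
move=> irr hf nz van T; elim=> [|i IH] B ie iB.
  exists unit, (fun=> fun v => f 0 v ^+ B); split; first by rewrite card_unit.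
    by move=> _; exact: hformX (hf 0 ie).
  move=> c hc []; have [L YL nL] : exists2 L, Y 0 L & ~ zeros (f 0) L.
    apply: contrapT => h; apply: (nz 0 ie) => L YL; apply: contrapT => nL.
    by apply: h; exists L.
  have [v v0 Lv] := projspace_gen L.
  have := hc L YL v; rewrite Lv memv_line => /(_ isT) /eqP.
  rewrite (bigD1 tt) //= big1 ?addr0; last by case.
  rewrite mulf_eq0 expf_eq0 => /orP[/eqP //|/andP[_ /eqP fv]].
  by case: nL; apply/(zerosP (hf 0 ie) Lv).
have {IH} h (j : 'I_T) : exists (I : finType) (p : I -> V -> K),
   [/\ #|I| = (T ^ i)%N, forall s, hform (delta * (B - j)) (p s) & independent_on (Y i) p].
  by apply: IH; [exact: ltnW|have := ltn_ord j; move: iB; rewrite mulSn; lia].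
have h' (j : 'I_T) : exists p : 'I_(T ^ i) -> V -> K,
   (forall s, hform (delta * (B - j)) (p s)) /\ independent_on (Y i) p.
  have [I [p [cI hp ip]]] := h j.
  exists (fun s => p (enum_val (cast_ord (esym cI) s))); split=> // c hc s.
  pose c' x := c (cast_ord cI (enum_rank x)).
  rewrite -[s](cast_ordKV cI) -[cast_ord _ s]enum_valK; apply: (ip c') => L /hc.
  congr zeros; apply/funext => v; rewrite /c' [RHS](reindex (fun s => enum_val (cast_ord (esym cI) s))) /=.
    by apply: eq_bigr => t _; rewrite enum_valK cast_ordKV.
  exists (fun x => cast_ord cI (enum_rank x)) => x _; first by rewrite enum_valK cast_ordKV.
  by rewrite cast_ordK enum_rankK.
have [p hp] := choice h'.
pose g j s v := f i.+1 v ^+ nat_of_ord j * p j s v.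
have hg j s : hform (delta * B) (g j s).
  have -> : (delta * B = delta * j + delta * (B - j))%N.
    rewrite -mulnDr; congr (_ * _)%N; have := ltn_ord j; move: iB; rewrite mulSn; lia.
  by apply: hformM; [exact: hformX (hf _ ie)|exact: (hp j).1].
exists ('I_T * 'I_(T ^ i))%type, (fun x => g x.1 x.2); split=> //.
  by rewrite card_prod !card_ord expnS.
move=> c hc.
have key (j : nat) : forall j' : 'I_T, (j' < j)%N -> forall s, c (j', s) = 0.
  elim: j => // j IH j'; rewrite ltnS leq_eqVlt => /orP[/eqP jj s|]; last exact: IH.
  have [sub vf] := van i ie.
  (* The terms with exponent less than [j] vanish by induction. Once the [j]-th
     power of [f i.+1] is cancelled, [tail] still vanishes on [Y i]. *)
  pose tail v := \sum_(k : 'I_T | (j < k)%N) \sum_s c (k, s) * (f i.+1 v ^+ (k - j)%N * p k s v).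
  pose lead v := \sum_s c (j', s) * p j' s v.
  have htail : hform (delta * (B - j')) tail.
    rewrite /tail; under eq_fun do rewrite big_mkcond.
    apply: hform_sum => k; have [jk|_] := ltnP j k; last exact: hform0.
    apply: hform_sum => t; apply: hformZ.
    have -> : (delta * (B - j') = delta * (k - j) + delta * (B - k))%N.
      rewrite -mulnDr; congr (_ * _)%N; have := ltn_ord k; move: iB; rewrite mulSn; lia.
    by apply: hformM; [exact: hformX (hf _ ie)|exact: (hp k).1].
  have hlead : hform (delta * (B - j')) lead.
    by apply: hform_sum => t; apply: hformZ; exact: (hp j').1.
  have : Y i.+1 `<=` zeros (fun v => f i.+1 v ^+ j * (lead v + tail v)).
    move=> L /hc; congr zeros; apply/funext => v.
    transitivity (\sum_k \sum_s c (k, s) * g k s v).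
      by rewrite pair_bigA; apply: eq_bigr => -[].
    rewrite (bigID (fun k : 'I_T => (k < j)%N)) /= big1 ?add0r; last first.
      by move=> k kj; rewrite big1 // => t _; rewrite IH // mul0r.
    rewrite (bigD1 j') /=; last by rewrite jj ltnn.
    rewrite mulrDr mulr_sumr mulr_sumr; congr (_ + _).
      by apply: eq_bigr => t _; rewrite /g jj mulrCA.
    apply: eq_big => [k|k /andP[kj kj']].
      rewrite -leqNgt [RHS]ltn_neqAle andbC; congr (_ && _).
      by rewrite -jj eq_sym; apply/idP/idP => /eqP h1; apply/eqP => h2; apply: h1;
        [apply: val_inj|rewrite h2].
    rewrite mulr_sumr; apply: eq_bigr => t _; rewrite /g [in RHS]mulrCA [f i.+1 v ^+ j * _]mulrA -exprD.
    by rewrite subnKC // leqNgt.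
  have hj : hform (delta * j) (fun v => f i.+1 v ^+ j) by exact: hformX (hf _ ie).
  move/(irreducible_zerosM hj (hformD hlead htail) (irr _ ie)) => [] h1.
    case: (nz _ ie) => L /h1; have [v v0 Lv] := projspace_gen L.
    move/(zerosP hj Lv)/eqP; rewrite expf_eq0 => /andP[_ /eqP fv].
    by apply/(zerosP (hf _ ie) Lv).
  apply: ((hp j').2 (fun s => c (j', s))) => L YL.
  have [v v0 Lv] := projspace_gen L; apply/(zerosP hlead Lv).
  have /(zerosP (hformD hlead htail) Lv) := h1 _ (sub _ YL).
  have /(zerosP (hf _ ie) Lv) f0 := vf _ YL.
  rewrite /tail big1 ?addr0 // => k jk; rewrite big1 // => t _.
  by rewrite f0 expr0n subn_eq0 leqNgt jk /= mul0r mulr0.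
by move=> [j s]; apply: (key T).
Qed.

Lemma irreducible_open_dense Y F d f : irreducible Y -> closed F -> hform d f ->
  ~ Y `<=` F -> Y `\` F `<=` zeros f -> Y `<=` zeros f.
Proof.
move=> [_ irr] cF hf nF YF; have [|/nF[]|//] := irr _ _ cF (closed_zeros hf).
by move=> L YL; have [FL|nFL] := pselect (F L); [left|right; apply: YF].
Qed.

Lemma hform0_const f (v w : V) : hform 0 f -> f v = f w.
Proof.
move=> hf; have E u : f u = f 0.
  by have := hform_scale 0 u hf; rewrite scale0r expr0 mul1r.
by rewrite (E v) (E w).
Qed.

(** Growth comparison: a chain of length [e] yields [T ^ e] independent forms of
    degree [O(T)], whereas a local parametrization by [m] variables leaves room
    for [O(T ^ m)] of them only. *)
Theorem chain_length_le A m :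
  (forall L, A L -> exists F D (psi : 'rV[K]_m -> V), [/\ closed F, ~ F L,
     poly_map D psi &
     forall L', A L' -> ~ F L' -> exists x, val L' = <[psi x]>%VS]) ->
  forall e (Y : nat -> set (projspace V)), irreducible_chain A e Y -> (e <= m)%N.
Proof.
move=> par e Y [irr lt].
have subA i : (i <= e)%N -> Y i `<=` A.
  by move=> ie; have [_ [F _ ->]] := irr i ie; exact: subIsetl.
have [[L0 YL0] _] := (irr 0%N (leq0n _)).1.
have [F [D [psi [cF nF hpsi psiP]]]] := par L0 (subA 0%N (leq0n _) _ YL0).
have YL i : (i <= e)%N -> Y i L0.
  by elim: i => // i IH ie; apply: (lt i ie).1; apply: IH; exact: ltnW.
have sep i : exists df : nat * (V -> K), (i < e)%N ->
    [/\ hform df.1 df.2, Y i `<=` zeros df.2 & ~ Y i.+1 `<=` zeros df.2].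
  have [ie|ei] := boolP (i < e)%N; last by exists (0%N, fun=> 0).
  have [_ [G cG YG]] := irr i (ltnW ie).
  have [L [YL' nL]] : exists L, Y i.+1 L /\ ~ Y i L.
    have [_ n] := lt i ie; apply: contrapT => h; apply: n => L YL'.
    by apply: contrapT => nL; apply: h; exists L.
  have [//||d [f [hf Gf nf]]] := @closed_separation _ _ G L.
    by move=> GL; apply: nL; rewrite YG; split=> //; exact: subA YL'.
  exists (d, f) => _; split=> //=; first by rewrite YG => M [_ /Gf].
  by move=> /(_ L YL').
have {}[s hs] := choice sep.
have d_gt0 i : (i < e)%N -> (0 < (s i).1)%N.
  move=> ie; have [hf f0 nf] := hs i ie; rewrite lt0n; apply/eqP => d0; apply: nf => L _.
  have [v v0 Lv] := projspace_gen L; have [w w0 Lw] := projspace_gen L0.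
  move: hf; rewrite d0 => hf; apply/(zerosP hf Lv).
  have := (zerosP hf Lw).1 (f0 _ (YL i (ltnW ie))).
  by rewrite (hform0_const v w hf).
(* Powers of the separating forms, all of degree [delta]. *)
pose delta := (\prod_(i < e) (s i).1)%N.
have delta_gt0 : (0 < delta)%N by apply: prodn_gt0 => i; exact: d_gt0.
have dvd i : (i < e)%N -> ((s i).1 %| delta)%N.
  by move=> ie; rewrite /delta (bigD1 (Ordinal ie)) //= dvdn_mulr.
have [v0 v00 Lv0] := projspace_gen L0; have [i0 vi0] := exists_coord v00.
pose f i := if i is j.+1 then fun v => (s j).2 v ^+ (delta %/ (s j).1)
            else fun v : V => coords v i0 ^+ delta.
have hf i : (i <= e)%N -> hform delta (f i).
  case: i => [_|i ie]; last first.
    by rewrite -{1}(divnK (dvd i ie)) mulnC; apply: hformX; have [] := hs i ie.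
  by rewrite -[delta in hform delta]mul1n; apply/hformX/hform_lin/coords_scalar.
have nz i : (i <= e)%N -> ~ Y i `<=` zeros (f i).
  case: i => [_ /(_ _ YL0)/(zerosP (hf 0%N isT) Lv0)/eqP|i ie h].
    by rewrite expf_eq0 (negbTE vi0) andbF.
  have [hs1 _] := hs i ie; apply => L /h; have [v _ Lv] := projspace_gen L.
  move/(zerosP (hf i.+1 ie) Lv)/eqP; rewrite expf_eq0 => /andP[_ /eqP sv].
  by apply/(zerosP hs1 Lv).
have van i : (i < e)%N -> Y i `<=` Y i.+1 /\ Y i `<=` zeros (f i.+1).
  move=> ie; split; first by have [] := lt i ie.
  have [hs1 h _] := hs i ie.
  move=> L /h; have [v _ Lv] := projspace_gen L.
  move/(zerosP hs1 Lv) => sv; apply/(zerosP (hf i.+1 ie) Lv).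
  have k0 : (0 < delta %/ (s i).1)%N by rewrite divn_gt0 ?d_gt0 // dvdn_leq // dvd.
  by rewrite /f sv expr0n (gtn_eqF k0).
rewrite leqNgt; apply/negP => me.
(* The choice of [T] makes [T ^ m.+1] exceed [(C * T) ^ m]. *)
pose C := (D * (delta * e)).+1; pose T := (C ^ m).+1.
have [I [p [cI hp ip]]] := chain_independent (fun i ie => (irr i ie).1) hf nz van
  (leqnn e) (leqnn (e * T)).
have ip' : independent_on (Y e `\` F) p.
  move=> c hc; apply: ip; apply: irreducible_open_dense cF _ _ hc.
  - exact: (irr e (leqnn e)).1.
  - by apply: hform_sum => i; apply: hformZ; exact: hp.
  - by move=> /(_ _ (YL e (leqnn e))).
have parF L : (Y e `\` F) L -> exists x, val L = <[psi x]>%VS.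
  by move=> [YeL nFL]; apply: psiP => //; exact: subA YeL.
have := independent_card_le hpsi hp parF ip'; rewrite cI; apply/negP; rewrite -ltnNge.
have leX a b : (a <= b -> a ^ m <= b ^ m)%N.
  by case: (m) => // k ab; rewrite leq_exp2r.
apply: (@leq_ltn_trans ((C * T) ^ m)%N).
  apply: leX; rewrite /C mulSn; have : (0 < T)%N by []; nia.
rewrite expnMn; apply: (@leq_trans (T * T ^ m)%N).
  by rewrite ltn_mul2r ltnSn andbT expn_gt0.
by rewrite -expnS leq_pexp2l.
Qed.

(** A nonzero univariate polynomial has a non-root, so any two proper closed
    conditions can be avoided at once on a curve. *)
Lemma irreducible_curves (U : lmodType K) D E (psi : U -> V) Y : Y !=set0 ->
  poly_map D psi ->
  (forall L L', Y L -> Y L' -> exists u u' (g : U -> K),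
     [/\ val L = <[psi u]>%VS, val L' = <[psi u']>%VS, line_poly E g, g u != 0 &
      forall t, g (u + t *: (u' - u)) != 0 -> psi (u + t *: (u' - u)) != 0 /\
        forall M, val M = <[psi (u + t *: (u' - u))%R]>%VS -> Y M]) ->
  irreducible Y.
Proof.
move=> Y0 hpsi h; split=> // F G cF cG YFG; apply: contrapT => /not_orP[nF nG].
have [L [YL nFL]] : exists L, Y L /\ ~ F L.
  by apply: contrapT => n; apply: nF => L YL; apply: contrapT => nL; apply: n; exists L.
have [L' [YL' nGL']] : exists L, Y L /\ ~ G L.
  by apply: contrapT => n; apply: nG => M YM; apply: contrapT => nM; apply: n; exists M.
have [d [f [hf Ff nf]]] := closed_separation cF nFL.
have [d' [f' [hf' Gf' nf']]] := closed_separation cG nGL'.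
have [u [u' [g [Lu Lu' hg gu hY]]]] := h _ _ YL YL'.
have [P _ eP] := line_poly_form hpsi hf u (u' - u).
have [P' _ eP'] := line_poly_form hpsi hf' u (u' - u).
have [Q _ eQ] := hg u (u' - u).
have R0 : P * P' * Q != 0.
  rewrite !mulf_neq0 //.
  - apply/eqP => P0; apply: nf; apply/(zerosP hf Lu).
    by have := eP 0; rewrite scale0r addr0 P0 horner0.
  - apply/eqP => P0; apply: nf'; apply/(zerosP hf' Lu').
    by have := eP' 1; rewrite scale1r subrKC P0 horner0.
  - apply: contraNneq gu => Q0.
    by have := eQ 0; rewrite scale0r addr0 Q0 horner0 => ->.
have [t Rt] : exists t, (P * P' * Q).[t] != 0.
  apply: contrapT => n; case/negP: R0; apply/eqP.
  apply: (many_roots_eq0 (leqnSn _)) => a _.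
  by apply: contrapT => /eqP na; apply: n; exists a%:R.
move: Rt; rewrite !hornerM -eP -eP' -eQ !mulf_eq0 !negb_or -andbA => /and3P[/= Pt P't Qt].
have [psi0 YM] := hY t Qt; have [M Mt] := projspace_point psi0.
by have [/Ff|/Gf'] := YFG M (YM M Mt); [move/(zerosP hf Mt)|move/(zerosP hf' Mt)];
  apply/eqP.
Qed.

(** The chain consists of the closures of the images of the coordinate subspaces
    spanned by the first [i] basis vectors; the forms [f] tell them apart. *)
Theorem chart_chain A m D E (psi : 'rV[K]_m -> V) (g : 'rV[K]_m -> K) :
  poly_map D psi -> line_poly E g -> g 0 != 0 ->
  (forall x, g x != 0 -> psi x != 0 /\ forall L, val L = <[psi x]>%VS -> A L) ->
  (forall i, exists d f, hform d f /\
     forall x, g x != 0 -> f (psi x) = 0 <-> x 0 i = 0) ->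
  exists Y : nat -> set (projspace V), irreducible_chain A m Y.
Proof.
move=> hpsi hg g0 hA hsep.
pose W k (x : 'rV[K]_m) := forall i : 'I_m, (k <= i)%N -> x 0 i = 0.
pose S k : set (projspace V) := [set L : projspace V | exists x, [/\ W k x, g x != 0 & val L = <[psi x]>%VS]].
have SA k : S k `<=` A by move=> L [x [_ gx Lx]]; have [_] := hA x gx; apply.
have irrS k : irreducible (S k).
  apply: (irreducible_curves _ hpsi (E := E)).
    have [L L0] := projspace_point (hA 0 g0).1; exists L, 0; split=> // i _.
    by rewrite mxE.
  move=> L L' [x [Wx gx Lx]] [x' [Wx' gx' Lx']]; exists x, x', g; split=> // t gt.
  split=> [|M Mt]; first exact: (hA _ gt).1.
  exists (x + t *: (x' - x)); split=> // i ki.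
  by rewrite !mxE Wx // Wx' // subrr mulr0 addr0.
exists (fun k => A `&` closure (S k)); split=> [i _|i im].
  exact: irreducible_closure_in.
split.
  move=> L [AL cL]; split=> //; move: L cL {AL}; apply: closure_subset => L [x [Wx gx Lx]].
  by exists x; split=> // j ij; apply: Wx; exact: ltnW.
move=> sub; pose i0 := Ordinal im; have [d [f [hf fP]]] := hsep i0.
have Sf : closure (S i) `<=` zeros f.
  have /closure_id -> := closed_zeros hf; apply: closure_subset => L [x [Wx gx Lx]].
  by apply/(zerosP hf Lx)/(fP x gx); apply: Wx.
have [Q _ eQ] := hg 0 (delta_mx 0 i0).
have [t Rt] : exists t, ('X * Q).[t] != 0.
  apply: contrapT => n; have /eqP : 'X * Q = 0.
    apply: (many_roots_eq0 (leqnSn _)) => a _.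
    by apply: contrapT => /eqP na; apply: n; exists a%:R.
  rewrite mulf_eq0 polyX_eq0 /= => /eqP Q0.
  by move: g0; have := eQ 0; rewrite scale0r addr0 Q0 horner0 => ->; rewrite eqxx.
move: Rt; rewrite hornerM hornerX -eQ add0r mulf_eq0 negb_or => /andP[t0 gt].
have [psi0 AL] := hA _ gt; have [L Lt] := projspace_point psi0.
have SL : S i.+1 L.
  exists (t *: delta_mx 0 i0); split=> // j ij.
  by rewrite !mxE eqxx /= (_ : (j == i0) = false) ?mulr0 //; apply/eqP => jE; move: ij; rewrite jE ltnn.
have [_ /Sf /(zerosP hf Lt)] := sub L (conj (AL L Lt) (subset_closure SL)).
move/(fP _ gt)/eqP; rewrite !mxE !eqxx mulr1; exact/negP.
Qed.

End Dimension.

(** * Isotropic frames and reflections *)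

Section Frames.
Context {K : numFieldType} {n : nat}.
Implicit Types u v : 'rV[K]_n.

Definition dot u v : K := (u *m v^T) 0 0.

Lemma dotC u v : dot u v = dot v u.
Proof. by rewrite /dot -[in LHS](trmxK u) -trmx_mul mxE. Qed.

Lemma dotDl u u' v : dot (u + u') v = dot u v + dot u' v.
Proof. by rewrite /dot mulmxDl mxE. Qed.

Lemma dotZl a u v : dot (a *: u) v = a * dot u v.
Proof. by rewrite /dot -scalemxAl mxE. Qed.

Lemma dotBl u u' v : dot (u - u') v = dot u v - dot u' v.
Proof. by rewrite -scaleN1r dotDl dotZl mulN1r. Qed.

Lemma dotDr u v v' : dot u (v + v') = dot u v + dot u v'.
Proof. by rewrite ![dot u _]dotC dotDl. Qed.

Lemma dotZr a u v : dot u (a *: v) = a * dot u v.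
Proof. by rewrite ![dot u _]dotC dotZl. Qed.

Lemma dotBr u v v' : dot u (v - v') = dot u v - dot u v'.
Proof. by rewrite ![dot u _]dotC dotBl. Qed.

Lemma dot_row w w' (F : 'M[K]_(w, n)) (G : 'M[K]_(w', n)) i j :
  dot (row i F) (row j G) = (F *m G^T) i j.
Proof. by rewrite /dot !mxE; apply: eq_bigr => k _; rewrite !mxE. Qed.

(** The reflection in the hyperplane orthogonal to [v], multiplied by [dot v v]
    so as to be polynomial in [v]. *)
Definition hrefl v : 'M[K]_n := (dot v v)%:M - 2 *: (v^T *m v).

Definition refl v : 'M[K]_n := (dot v v)^-1 *: hrefl v.

Lemma mul_hrefl u v : u *m hrefl v = dot v v *: u - (2 * dot u v) *: v.
Proof.
rewrite /hrefl mulmxBr mul_mx_scalar -scalemxAr mulmxA.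
by rewrite [u *m v^T]mx11_scalar mul_scalar_mx scalerA.
Qed.

Lemma tr_hrefl v : (hrefl v)^T = hrefl v.
Proof. by rewrite /hrefl linearB linearZ /= tr_scalar_mx trmx_mul trmxK. Qed.

Lemma hrefl_sqr v : hrefl v *m hrefl v = (dot v v ^+ 2)%:M.
Proof.
have WW : v^T *m v *m (v^T *m v) = dot v v *: (v^T *m v).
  rewrite mulmxA -[v^T *m v *m _]mulmxA [v *m v^T]mx11_scalar.
  by rewrite mul_mx_scalar -scalemxAl.
rewrite /hrefl; move: WW; set B := v^T *m v; set a := dot v v => WW.
rewrite mulmxBl mul_scalar_mx mulmxBr mul_mx_scalar -scalemxAl -scalemxAr WW.
by apply/matrixP => i j; rewrite !mxE; case: (i == j); rewrite /= ?mulr1n ?mulr0n; ring.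
Qed.

Lemma hreflE v : dot v v != 0 -> hrefl v = dot v v *: refl v.
Proof. by move=> v0; rewrite /refl scalerA divff // scale1r. Qed.

Lemma mul_refl u v : dot v v != 0 -> u *m refl v = u - (2 * dot u v / dot v v) *: v.
Proof.
move=> v0; rewrite /refl -scalemxAr mul_hrefl scalerBr !scalerA mulVf // scale1r.
by rewrite [_^-1 * _]mulrC.
Qed.

Lemma refl_sqr v : dot v v != 0 -> refl v *m refl v = 1%:M.
Proof.
move=> v0; rewrite /refl -scalemxAl -scalemxAr hrefl_sqr scalerA -scalemx1 scalerA.
by rewrite expr2 mulrA mulfVK // mulVf // scale1r.
Qed.

Lemma tr_refl v : (refl v)^T = refl v.
Proof. by rewrite /refl linearZ /= tr_hrefl. Qed.

Definition refls (vs : seq 'rV[K]_n) : 'M[K]_n :=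
  foldr (fun v A => refl v *m A) 1%:M vs.

Definition anisotropic (vs : seq 'rV[K]_n) := all (fun v => dot v v != 0) vs.

Lemma refls_cat vs vs' : refls (vs ++ vs') = refls vs *m refls vs'.
Proof. by elim: vs => [|v vs IH] /=; rewrite ?mul1mx // IH mulmxA. Qed.

Lemma refls_orthogonal vs : anisotropic vs -> refls vs *m (refls vs)^T = 1%:M.
Proof.
elim: vs => [_|v vs IH /andP[v0 /IH e]] /=; first by rewrite trmx1 mulmx1.
by rewrite trmx_mul mulmxA -[_ *m refls vs *m _]mulmxA e mulmx1 tr_refl refl_sqr.
Qed.

Definition isotropic w (F : 'M[K]_(w, n)) := F *m F^T = 0.

Lemma isotropic_mulr w (F : 'M[K]_(w, n)) Q :
  Q *m Q^T = 1%:M -> isotropic F -> isotropic (F *m Q).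
Proof.
by move=> hQ hF; rewrite /isotropic trmx_mul mulmxA -[F *m Q *m _]mulmxA hQ mulmx1.
Qed.

(** A nondegenerate bilinear form separates a vector from a subspace. *)
Lemma exists_orthogonal m (A : 'M[K]_(m, n)) u : ~~ (u <= A)%MS ->
  exists2 v, A *m v^T = 0 & dot u v != 0.
Proof.
rewrite submxE => h; have [k uk] : exists k, (u *m cokermx A) 0 k != 0.
  apply/existsP; apply: contraNT h; rewrite negb_exists => /forallP h.
  by apply/eqP/rowP => k; have := h k; rewrite negbK => /eqP ->; rewrite mxE.
exists (col k (cokermx A))^T; rewrite ?/dot trmxK; first by rewrite colE mulmxA mulmx_coker mul0mx.
by rewrite colE mulmxA -colE mxE.
Qed.

Lemma exists_orthogonal2 m (A : 'M[K]_(m, n)) u u' :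
  ~~ (u <= A)%MS -> ~~ (u' <= A)%MS ->
  exists v, [/\ A *m v^T = 0, dot u v != 0 & dot u' v != 0].
Proof.
move=> /exists_orthogonal[v Av uv] /exists_orthogonal[v' Av' uv'].
have [u'v|u'v] := eqVneq (dot u' v) 0; last by exists v.
have [uv'0|uv'0] := eqVneq (dot u v') 0; last by exists v'.
exists (v + v'); rewrite linearD /= mulmxDr Av Av' addr0 !dotDr u'v uv'0 addr0 add0r.
by split.
Qed.

Lemma row_free_notin w (F : 'M[K]_(w, n)) (j : 'I_w) : row_free F ->
  ~~ (row j F <= \matrix_(i < w) (if (i < j)%N then row i F else 0))%MS.
Proof.
move=> /row_freeP[G FG]; apply/negP => /submxP[D e].
pose c : 'rV[K]_w := \row_i (if (i < j)%N then D 0 i else 0) - delta_mx 0 j.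
have cF : c *m F = 0.
  rewrite mulmxBl -rowE e; apply/eqP; rewrite subr_eq0; apply/eqP.
  rewrite !mulmx_sum_row; apply: eq_bigr => i _; rewrite rowK !mxE.
  by case: ifP; rewrite ?scale0r ?scaler0.
have : c = 0 by rewrite -[c]mulmx1 -FG mulmxA cF mul0mx.
move/rowP/(_ j); rewrite !mxE ltnn !eqxx sub0r => /eqP.
by rewrite oppr_eq0 oner_eq0.
Qed.

(** Witt's theorem for isotropic frames. One reflection maps [f] to [e] unless
    they are orthogonal; in that case an isotropic vector orthogonal to neither
    serves as a stepping stone. *)
Theorem witt_isotropic w (F E : 'M[K]_(w, n)) :
  isotropic F -> row_free F -> isotropic E -> row_free E ->
  exists vs, [/\ anisotropic vs, (size vs <= 2 * w)%N & F *m refls vs = E].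
Proof.
move=> isoF freeF isoE freeE.
suff H j : (j <= w)%N -> exists vs, [/\ anisotropic vs, (size vs <= 2 * j)%N &
    forall i : 'I_w, (i < j)%N -> row i (F *m refls vs) = row i E].
  have [vs [h1 h2 h3]] := H w (leqnn w); exists vs; split=> //.
  by apply/row_matrixP => i; apply: h3.
elim: j => [_|j IH jw]; first by exists [::]; split.
have [vs [ani sz fix_]] := IH (ltnW jw).
pose F' := F *m refls vs; pose j0 := Ordinal jw.
have isoF' : isotropic F' by apply: isotropic_mulr isoF; exact: refls_orthogonal.
have freeF' : row_free F'.
  have [G FG] := row_freeP freeF; apply/row_freeP.
  by exists ((refls vs)^T *m G); rewrite mulmxA -[F' *m _]mulmxA refls_orthogonal // mulmx1.
pose e := row j0 E; pose f := row j0 F'.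
have ee : dot e e = 0 by rewrite dot_row isoE mxE.
have ff : dot f f = 0 by rewrite dot_row isoF' mxE.
have fi (i : 'I_w) : (i < j)%N -> dot (row i E) e = 0 /\ dot (row i E) f = 0.
  move=> ij; split; first by rewrite dot_row isoE mxE.
  by rewrite -(fix_ i ij) dot_row isoF' mxE.
have step x y (v := x - y) : dot x x = 0 -> dot y y = 0 -> dot x y != 0 ->
    (dot v v != 0) /\ x *m refl v = y.
  move=> xx yy xy; have vv : dot v v = - (2 * dot x y).
    by rewrite /v dotBl !dotBr xx yy [dot y x]dotC; ring.
  have v0 : dot v v != 0 by rewrite vv oppr_eq0 mulf_neq0 // pnatr_eq0.
  split=> //; rewrite mul_refl // vv /v dotBr xx sub0r mulrN divrr ?scale1r ?subKr //.
  by rewrite unitfE -mulrN; rewrite vv -mulrN in v0.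
have keep u v : dot v v != 0 -> dot u v = 0 -> u *m refl v = u.
  by move=> v0 uv; rewrite mul_refl // uv mulr0 mul0r scale0r subr0.
have finish ws : anisotropic ws -> (size ws <= 2)%N -> f *m refls ws = e ->
    (forall i : 'I_w, (i < j)%N -> row i E *m refls ws = row i E) ->
    exists vs, [/\ anisotropic vs, (size vs <= 2 * j.+1)%N &
    forall i : 'I_w, (i < j.+1)%N -> row i (F *m refls vs) = row i E].
  move=> aws sws fe ei; exists (vs ++ ws); split.
  - by rewrite /anisotropic all_cat; apply/andP.
  - rewrite size_cat; lia.
  - move=> i; rewrite refls_cat mulmxA row_mul ltnS leq_eqVlt => /orP[/eqP ij|ij].
      by have -> : i = j0 by apply: val_inj.
    by rewrite fix_ // ei.
have [fe|fe] := eqVneq (dot f e) 0; last first.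
  have [v0 fve] := step f e ff ee fe.
  apply: (finish [:: f - e]); rewrite /= ?v0 ?mulmx1 // => i ij.
  by rewrite keep // dotBr (fi i ij).1 (fi i ij).2 subr0.
pose A := \matrix_(i < w) (if (i < j0)%N then row i E else 0).
have eA : ~~ (e <= A)%MS by exact: row_free_notin.
have fA : ~~ (f <= A)%MS.
  have -> : A = \matrix_(i < w) (if (i < j0)%N then row i F' else 0).
    by apply/row_matrixP => i; rewrite !rowK; case: ifP => // ij; rewrite fix_.
  exact: row_free_notin.
have [u [Au eu fu]] := exists_orthogonal2 eA fA.
have Eu (i : 'I_w) : (i < j)%N -> dot (row i E) u = 0.
  move=> ij; have -> : row i E = row i A by rewrite rowK /= ij.
  by rewrite /dot -row_mul Au !mxE.
pose g := u - (dot u u / (2 * dot e u)) *: e.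
have gg : dot g g = 0.
  rewrite /g dotBl !dotBr !dotZl !dotZr ee [dot u e]dotC; field.
  by rewrite eu.
have fg : dot f g != 0 by rewrite /g dotBr dotZr fe mulr0 subr0.
have ge : dot g e != 0 by rewrite /g dotBl dotZl ee mulr0 subr0 dotC.
have gi (i : 'I_w) : (i < j)%N -> dot (row i E) g = 0.
  by move=> ij; rewrite /g dotBr dotZr Eu // (fi i ij).1 mulr0 subr0.
have [v0 fvg] := step f g ff gg fg; have [v0' gve] := step g e gg ee ge.
apply: (finish [:: f - g; g - e]); rewrite /= ?v0 ?v0' ?mulmx1 //.
  by rewrite mulmxA fvg.
move=> i ij; rewrite mulmxA !keep // dotBr gi // ?(fi i ij).1 ?(fi i ij).2 subr0 //.
Qed.

End Frames.

(** * Normal forms of skew-symmetric matrices *)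

Section SkewForms.
Context {K : numFieldType}.

(** The nondegenerate skew form pairing [2 j] with [2 j + 1]. *)
Definition symp w : 'M[K]_w := \matrix_(i, j)
  ((~~ odd i && (j == i.+1 :> nat))%:R - (~~ odd j && (i == j.+1 :> nat))%:R).

Lemma tr_symp w : (symp w)^T = - symp w.
Proof. by apply/matrixP => i j; rewrite !mxE opprB. Qed.

Lemma sympSS w : symp w.+2 = block_mx (symp 2) 0 0 (symp w) :> 'M_(2 + w).
Proof.
apply/matrixP => i j.
rewrite -(splitK i) -(splitK j); case: (split i) => {}i; case: (split j) => {}j /=;
rewrite ?block_mxEul ?block_mxEur ?block_mxEdl ?block_mxEdr !mxE /= ?negbK //.
- by case: i => [[|[|i]] hi] //=; rewrite ?andbF /= subrr.
- by case: j => [[|[|j]] hj] //=; rewrite ?andbF /= subrr.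
Qed.

Lemma symp_unit w : ~~ odd w -> symp w \in unitmx.
Proof.
elim/ltn_ind: w => -[|[|w]] IH //= ow; first by rewrite unitmxE det_mx00 unitr1.
rewrite sympSS unitmxE (@det_ublock _ 2 w) unitrM; apply/andP; split; last first.
  by rewrite -unitmxE IH // -(negbK (odd w)).
rewrite (expand_det_row _ ord0) !big_ord_recl big_ord0 /cofactor !det_mx11 !mxE /=.
by rewrite !subr0 mul0r add0r addr0 mul1r sub0r expr1 mulrNN mulr1 unitr1.
Qed.

Lemma skew_diag w (S : 'M[K]_w) i : S^T = - S -> S i i = 0.
Proof.
move/matrixP/(_ i i); rewrite !mxE => /eqP; rewrite -subr_eq0 opprK -mulr2n mulrn_eq0 /=.
by move/eqP.
Qed.

Lemma skew_congr w w' (S : 'M[K]_w) (P : 'M[K]_(w', w)) :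
  S^T = - S -> (P *m S *m P^T)^T = - (P *m S *m P^T).
Proof. by move=> hS; rewrite !trmx_mul trmxK hS mulNmx mulmxN mulmxA. Qed.

Lemma skew_dim1 (S : 'M[K]_1) : S^T = - S -> S \notin unitmx.
Proof. by move=> hS; rewrite unitmxE det_mx11 skew_diag // unitr0. Qed.

(** One step of symplectic Gram-Schmidt. *)
Lemma skew_split_plane w (S : 'M[K]_(2 + w)) : S^T = - S -> S \in unitmx ->
  exists2 P : 'M[K]_(2 + w), P \in unitmx &
  exists S', P *m S *m P^T = block_mx (symp 2) 0 0 S'.
Proof.
move=> hS uS.
have [j Sj] : exists j, S 0 j != 0.
  apply/existsP; apply: contraTT uS; rewrite negb_exists => /forallP h.
  rewrite unitmxE (expand_det_row _ 0) big1 ?unitr0 // => j _.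
  by have := h j; rewrite negbK => /eqP ->; rewrite mul0r.
have j0 : j != 0 by apply: contraNneq Sj => ->; rewrite skew_diag.
pose one : 'I_(2 + w) := lift 0 0.
pose S1 := tperm_mx j one *m S *m (tperm_mx j one)^T.
have hS1 : S1^T = - S1 by exact: skew_congr.
have S101 : S1 0 one = S 0 j.
  rewrite /S1 tr_tperm_mx -xcolE -xrowE !mxE tpermR tpermD //.
have S1def : S1 = tperm_mx j one *m S *m (tperm_mx j one)^T by [].
move: S101 Sj; set x := S 0 j => S101 x0; clearbody x S1.
have S1_skew a b : S1 a b = - S1 b a.
  by move/matrixP/(_ b a): hS1; rewrite !mxE.
pose A := ulsubmx S1.
have AE : A = x *: symp 2.
  apply/matrixP => a b; rewrite !mxE.
  have E01 : S1 (lshift w 0) (lshift w (lift 0 0)) = x.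
    by rewrite -S101; congr (S1 _ _); apply: val_inj.
  have E10 : S1 (lshift w (lift 0 0)) (lshift w 0) = - x.
    by rewrite -E01; move/matrixP/(_ (lshift w 0) (lshift w (lift 0 0))): hS1; rewrite !mxE.
  case: a b => [[|[|a]] ha] [[|[|b]] hb] //=.
  - rewrite (_ : lshift w _ = lshift w 0); last exact: val_inj.
    rewrite (_ : Ordinal hb = 0); last exact: val_inj.
    by rewrite skew_diag // subrr mulr0.
  - rewrite subr0 mulr1 -E01; congr (S1 _ _); exact: val_inj.
  - rewrite sub0r mulrN1 -E10; congr (S1 _ _); exact: val_inj.
  - rewrite (_ : lshift w _ = lshift w (lift 0 0)); last exact: val_inj.
    rewrite (_ : Ordinal hb = lift 0 0); last exact: val_inj.
    by rewrite skew_diag // subrr mulr0.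
have uA : A \in unitmx by rewrite AE unitmxZ ?unitfE // symp_unit.
pose D : 'M[K]_2 := diag_mx (\row_i (if i == 0 then x^-1 else 1)).
pose B := ursubmx S1.
have S1E : S1 = block_mx A B (- B^T) (drsubmx S1).
  rewrite -[LHS]submxK; congr block_mx.
  by apply/matrixP => a b; rewrite !mxE S1_skew.
have hA : A^T = - A by apply/matrixP => a b; rewrite !mxE S1_skew.
have hAV : (invmx A)^T = - invmx A.
  by rewrite trmx_inv hA -scaleN1r invmxZ ?scaleN1r ?invrN1 ?scaleN1r // -scaleN1r unitmxZ ?unitrN1.
pose P2 : 'M[K]_(2 + w) := block_mx D 0 (B^T *m invmx A) 1%:M.
exists (P2 *m tperm_mx j one).
  rewrite unitmx_mul unitmx_perm andbT unitmxE det_lblock det1 mulr1 det_diag.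
  by rewrite !big_ord_recl big_ord0 !mxE /= !mulr1 unitfE invr_eq0.
have -> : P2 *m tperm_mx j one *m S *m (P2 *m tperm_mx j one)^T = P2 *m S1 *m P2^T.
  by rewrite S1def trmx_mul !mulmxA.
rewrite S1E /P2 (tr_block_mx D) !mulmx_block !mul0mx !addr0 !trmx0 !trmx1 !mul1mx.
rewrite mulmxKV // subrr !mul0mx !mulmx0 !add0r !addr0 !mulmx1.
rewrite trmx_mul trmxK hAV mulNmx mulmxN.
have -> : D *m A *m (invmx A *m B) = D *m B by rewrite mulmxA mulmxK.
rewrite addNr; eexists; congr block_mx.
apply/matrixP => a b; rewrite AE /D tr_diag_mx mul_mx_diag mul_diag_mx !mxE.
case: a b => [[|[|a]] ha] [[|[|b]] hb] //=; rewrite ?subrr ?mulr0 ?mul0r //.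
  by rewrite subr0 !mulr1 mulVf.
by rewrite sub0r mulrN1 mul1r mulNr mulfV.
Qed.

Theorem skew_normal_form w (S : 'M[K]_w) : S^T = - S -> S \in unitmx ->
  ~~ odd w /\ exists2 P, P \in unitmx & P *m S *m P^T = symp w.
Proof.
elim/ltn_ind: w S => -[|[|w]] IH S hS uS.
- by split=> //; exists 1%:M; [exact: unitmx1|apply/matrixP => -[]].
- by move: (skew_dim1 hS); rewrite uS.
have [P uP [S' e]] := @skew_split_plane w S hS uS.
have : (P *m S *m P^T) \in unitmx by rewrite !unitmx_mul uP uS unitmx_tr.
rewrite e unitmxE det_ublock unitrM -!unitmxE => /andP[_ uS'].
have hS' : S'^T = - S'.
  have := skew_congr P hS; rewrite e tr_block_mx opp_block_mx.
  by move/eq_block_mx => [].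
have [ow [P' uP' e']] := IH w (leqW (leqnn _)) S' hS' uS'.
split; first by rewrite /= negbK.
pose M : 'M[K]_(2 + w) := block_mx 1%:M 0 0 P'.
exists (M *m P).
  by rewrite unitmx_mul uP andbT unitmxE (@det_ublock _ 2 w) det1 mul1r -unitmxE.
have -> : M *m P *m S *m (M *m P)^T = M *m (P *m S *m P^T) *m M^T.
  by rewrite trmx_mul !mulmxA.
rewrite e /M (@tr_block_mx _ 2 w 2 w) !trmx0 trmx1 !(@mulmx_block _ 2 w 2 w 2 w).
by rewrite !mul0mx !mulmx0 !addr0 !add0r !mulmx1 !mul1mx ?mul0mx e' [RHS]sympSS.
Qed.

End SkewForms.

(** * Square-zero skew-symmetric matrices *)

Section Strata.
Context {K : numFieldType} {n : nat}.
Implicit Types X : 'M[K]_n.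

(** Square-zero skew matrices of rank [w]: nondegenerate skew forms on
    isotropic subspaces of dimension [w]. *)
Definition stratum w X := exists (F : 'M[K]_(w, n)) (S : 'M[K]_w),
  [/\ isotropic F, row_free F, S^T = - S, S \in unitmx & X = F^T *m S *m F].

Lemma isotropic_rank w (F : 'M[K]_(w, n)) : isotropic F -> row_free F -> (2 * w <= n)%N.
Proof.
move=> iso free; have := mulmx0_rank_max iso.
by rewrite mxrank_tr (eqP free) addnn mul2n.
Qed.

Lemma isotropic_mull w w' (A : 'M[K]_(w', w)) (F : 'M[K]_(w, n)) :
  isotropic F -> isotropic (A *m F).
Proof.
by move=> iso; rewrite /isotropic trmx_mul mulmxA -[_ *m F *m F^T]mulmxA iso mulmx0 mul0mx.
Qed.

Lemma isotropic_sqr0 w (F : 'M[K]_(w, n)) (S : 'M[K]_w) X :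
  isotropic F -> X = F^T *m S *m F -> X *m X = 0.
Proof.
move=> iso ->; rewrite -!mulmxA [F *m (F^T *m _)]mulmxA iso.
by rewrite mul0mx !mulmx0.
Qed.

Lemma skew_sandwich w (F : 'M[K]_(w, n)) (S : 'M[K]_w) :
  S^T = - S -> (F^T *m S *m F)^T = - (F^T *m S *m F).
Proof. by move=> hS; have := skew_congr F^T hS; rewrite trmxK. Qed.

Lemma stratum_skew w X : stratum w X -> X^T = - X.
Proof. by move=> [F [S [_ _ hS _ ->]]]; exact: skew_sandwich. Qed.

Lemma stratum_sqr0 w X : stratum w X -> X *m X = 0.
Proof. by move=> [F [S [iso _ _ _ e]]]; exact: isotropic_sqr0 iso e. Qed.

(** The form [S] is [X] itself, restricted to a complement of its kernel. *)
Lemma sqr0_factor_stratum p (D : 'M[K]_(n, p)) (F : 'M[K]_(p, n)) X :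
  row_free F -> X = D *m F -> (p <= \rank X)%N ->
  X^T = - X -> X *m X = 0 -> stratum p X.
Proof.
move=> free X_F rX hX XX; have [G FG] := row_freeP free.
have XGF : X *m (G *m F) = X by rewrite X_F -mulmxA [F *m _]mulmxA FG mul1mx.
pose S := G^T *m X *m G.
have X_S : X = F^T *m S *m F.
  rewrite /S -!mulmxA XGF mulmxA -trmx_mul.
  by have := congr1 trmx XGF; rewrite [in LHS]trmx_mul hX mulmxN => /oppr_inj.
have hS : S^T = - S by have := skew_congr G^T hX; rewrite trmxK.
have uS : S \in unitmx.
  rewrite -row_full_unit /row_full eqn_leq rank_leq_row /=.
  apply: (leq_trans rX); rewrite X_S.
  by apply: leq_trans (mxrankM_maxl _ _) _; exact: mxrankM_maxr.
clearbody S; exists F, S; split=> //.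
have : G^T *m (X *m X) *m G = S *m (F *m F^T) *m S.
  rewrite X_S !mulmxA -trmx_mul FG trmx1 mul1mx.
  by rewrite -[_ *m F *m G]mulmxA FG mulmx1.
rewrite XX mulmx0 mul0mx => /esym /(congr1 (mulmx (invmx S))).
rewrite mulmx0 !mulmxA mulVmx // mul1mx => /(congr1 (mulmx^~ (invmx S))).
by rewrite mul0mx mulmxK.
Qed.

Lemma sqr0_stratum X : X^T = - X -> X *m X = 0 -> stratum (\rank X) X.
Proof.
exact: sqr0_factor_stratum (row_base_free X) (esym (mulmx_base X)) (leqnn _).
Qed.

Lemma stratum_parity w X : stratum w X -> ~~ odd w /\ (2 * w <= n)%N.
Proof.
move=> [F [S [iso free hS uS _]]]; split; last exact: isotropic_rank iso free.
by have [] := skew_normal_form hS uS.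
Qed.

Lemma stratum_neq0 w X : (0 < w)%N -> stratum w X -> X != 0.
Proof.
move=> w0 [F [S [_ free _ uS ->]]]; have [G FG] := row_freeP free.
apply: contraTneq uS => X0.
have : G^T *m (F^T *m S *m F) *m G = S.
  by rewrite !mulmxA -trmx_mul FG trmx1 mul1mx -mulmxA FG mulmx1.
rewrite X0 mulmx0 mul0mx => <-.
by case: (w) w0 => // k _; rewrite unitmxE det0 unitr0.
Qed.

Lemma stratum_symp w X : stratum w X ->
  exists F : 'M[K]_(w, n), [/\ isotropic F, row_free F & X = F^T *m symp w *m F].
Proof.
move=> [F [S [iso free hS uS ->]]]; have [_ [P uP e]] := skew_normal_form hS uS.
exists (invmx P^T *m F); split.
- exact: isotropic_mull.
- by rewrite /row_free eqmxMfull // row_full_unit unitmx_inv unitmx_tr.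
- rewrite trmx_mul trmx_inv trmxK -e !mulmxA -[_ *m invmx P *m P]mulmxA mulVmx // mulmx1.
  by rewrite -[_ *m P^T *m _]mulmxA mulmxV ?unitmx_tr // mulmx1.
Qed.

Lemma symp_stratum w (F : 'M[K]_(w, n)) : isotropic F -> row_free F -> ~~ odd w ->
  stratum w (F^T *m symp w *m F).
Proof.
by move=> iso free ow; exists F, (symp w); split=> //; [exact: tr_symp|exact: symp_unit].
Qed.

Lemma stratum_conj w X Q : Q^T *m Q = 1%:M -> stratum w X -> stratum w (Q^T *m X *m Q).
Proof.
move=> hQ [F [S [iso free hS uS ->]]].
have hQ' : Q *m Q^T = 1%:M by exact: mulmx1C.
exists (F *m Q), S; split=> //; first exact: isotropic_mulr.
  have [G FG] := row_freeP free; apply/row_freeP.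
  by exists (Q^T *m G); rewrite mulmxA -[F *m Q *m _]mulmxA hQ' mulmx1.
by rewrite trmx_mul !mulmxA.
Qed.

(** Up to a change of frame, both matrices carry the same form [symp w]. *)
Theorem stratum_transitive w X X' : stratum w X -> stratum w X' ->
  exists2 Q, Q^T *m Q = 1%:M & X' = Q^T *m X *m Q.
Proof.
move=> /stratum_symp[F [iso free ->]] /stratum_symp[F' [iso' free' ->]].
have [vs [ani _ e]] := witt_isotropic iso free iso' free'.
exists (refls vs); first exact/mulmx1C/refls_orthogonal.
by rewrite -e trmx_mul !mulmxA.
Qed.

(** A smaller isotropic frame can be moved into [E], so that a bounded number of
    reflections and a possibly degenerate form on [E] reach all of [X *m X = 0]. *)
Lemma sqr0_frame w (E : 'M[K]_(w, n)) X : isotropic E -> row_free E ->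
  (\rank X <= w)%N -> X^T = - X -> X *m X = 0 ->
  exists vs (T : 'M[K]_w), [/\ anisotropic vs, (size vs <= 2 * w)%N, T^T = - T &
     X = (E *m refls vs)^T *m T *m (E *m refls vs)].
Proof.
move=> iso free rw hX XX; have [F [S [isoF freeF hS _ XF]]] := sqr0_stratum hX XX.
move: F S isoF freeF hS XF; move: (\rank X) rw => p pw F S isoF freeF hS XF.
move: E iso free; rewrite -(subnKC pw); move: (w - p)%N => d {pw} E iso free.
have uE : usubmx E = row_mx 1%:M 0 *m E.
  by rewrite -[in RHS](vsubmxK E) mul_row_col mul1mx mul0mx addr0.
have EE : isotropic (usubmx E) by rewrite uE; exact: isotropic_mull.
have freeE : row_free (usubmx E).
  have [G EG] := row_freeP free; apply/row_freeP; exists (G *m col_mx 1%:M 0).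
  rewrite uE mulmxA -[_ *m E *m G]mulmxA EG mulmx1.
  by rewrite mul_row_col mul1mx mul0mx addr0.
have [vs [ani sz e]] := witt_isotropic EE freeE isoF freeF.
exists vs, (block_mx S 0 0 0); split=> //.
- by rewrite (leq_trans sz) // leq_mul2l leq_addr.
- by rewrite tr_block_mx !trmx0 hS opp_block_mx !oppr0.
- rewrite XF -e -[in RHS](vsubmxK E) mul_col_mx tr_col_mx mul_row_block.
  by rewrite !mulmx0 !addr0 mul_row_col mul0mx addr0.
Qed.

End Strata.

(** * Affine charts of the strata *)

Section Chart.
Context {K : numFieldType} {n w r : nat}.
Variables (E E' : 'M[K]_(w, n)) (Z : 'M[K]_(r, n)).

(** The rows of [E], [E'] and [Z] form a basis of the space of row vectors, in
    which [E] and [E'] are dual isotropic frames and [Z] is orthonormal. *)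
Definition witt_basis :=
  [/\ isotropic E, isotropic E', E *m E'^T = 1%:M & Z *m Z^T = 1%:M] /\
  [/\ E *m Z^T = 0, E' *m Z^T = 0 & E^T *m E' + E'^T *m E + Z^T *m Z = 1%:M].

(** For [s] skew-symmetric, the row spaces of these matrices are the isotropic
    subspaces that the pairing puts in duality with the row space of [E']. *)
Definition chart_frame (s : 'M[K]_w) (c : 'M[K]_(w, r)) : 'M[K]_(w, n) :=
  E + (s - 2^-1 *: (c *m c^T)) *m E' + c *m Z.

Hypothesis basis : witt_basis.

Lemma witt_basis_sym : [/\ E' *m E^T = 1%:M, Z *m E^T = 0 & Z *m E'^T = 0].
Proof.
have [[_ _ e _] [e1 e2 _]] := basis.
by split; rewrite -[LHS]trmxK trmx_mul trmxK ?e ?e1 ?e2 ?trmx1 ?trmx0.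
Qed.

Lemma chart_frame_dual s c : chart_frame s c *m E'^T = 1%:M.
Proof.
have [[_ e' e _] _] := basis; have [_ _ z] := witt_basis_sym.
by rewrite /chart_frame; move: (s - _) => a; rewrite !mulmxDl -!mulmxA e e' z !mulmx0 !addr0.
Qed.

Lemma chart_frame_E s c : chart_frame s c *m E^T = s - 2^-1 *: (c *m c^T).
Proof.
have [[e _ _ _] _] := basis; have [e' z _] := witt_basis_sym.
by rewrite /chart_frame; move: (s - _) => a; rewrite !mulmxDl -!mulmxA e e' z mulmx0 mulmx1 addr0 add0r.
Qed.

Lemma chart_frame_Z s c : chart_frame s c *m Z^T = c.
Proof.
have [[_ _ _ z] [e e' _]] := basis.
by rewrite /chart_frame; move: (s - _) => a; rewrite !mulmxDl -!mulmxA e e' z mulmx0 mulmx1 !add0r.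
Qed.

Lemma chart_frame_free s c : row_free (chart_frame s c).
Proof. by apply/row_freeP; exists E'^T; exact: chart_frame_dual. Qed.

Lemma gram_coordinates (F : 'M[K]_(w, n)) : F *m E'^T = 1%:M ->
  F *m F^T = F *m E^T + (F *m E^T)^T + (F *m Z^T) *m (F *m Z^T)^T.
Proof.
move=> FE'; have [_ [_ _ one]] := basis.
transitivity (F *m 1%:M *m F^T); first by rewrite mulmx1.
rewrite -one !mulmxDr !mulmxDl.
rewrite !trmx_mul !trmxK !mulmxA FE' mul1mx; congr (_ + _ + _).
have /(congr1 trmx) := FE'; rewrite trmx_mul trmxK trmx1 => e.
by rewrite -[_ *m E' *m _]mulmxA e mulmx1.
Qed.

Lemma chart_frame_isotropic s c : s^T = - s -> isotropic (chart_frame s c).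
Proof.
move=> hs; rewrite /isotropic gram_coordinates ?chart_frame_dual //.
rewrite chart_frame_E chart_frame_Z.
have -> : (s - 2^-1 *: (c *m c^T))^T = - s - 2^-1 *: (c *m c^T).
  by rewrite linearB /= hs linearZ /= trmx_mul trmxK.
by apply/matrixP => i j; rewrite !mxE; field.
Qed.

(** The chart covers the square-zero matrices of rank [w] whose restriction to
    [E'] is nondegenerate. *)
Lemma chart_surjective X : stratum w X -> E' *m X *m E'^T \in unitmx ->
  exists s c, s^T = - s /\
    X = (chart_frame s c)^T *m (E' *m X *m E'^T) *m chart_frame s c.
Proof.
move=> [F0 [S [iso _ _ _ ->]]] uX.
pose H := F0 *m E'^T; have H_X : E' *m (F0^T *m S *m F0) *m E'^T = H^T *m S *m H.
  by rewrite /H trmx_mul trmxK !mulmxA.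
move: uX; rewrite H_X => uX.
have uH : H \in unitmx by move: uX; rewrite unitmx_mul => /andP[].
pose F := invmx H *m F0.
have FE' : F *m E'^T = 1%:M by rewrite /F -mulmxA mulVmx.
have isoF : F *m F^T = 0 by exact: isotropic_mull.
have [_ [_ _ one]] := basis.
pose c := F *m Z^T; pose s := F *m E^T + 2^-1 *: (c *m c^T).
have F_s : F = chart_frame s c.
  rewrite /chart_frame /s addrK -[LHS]mulmx1 -one !mulmxDr !mulmxA FE' mul1mx.
  by congr (_ + _); rewrite addrC.
exists s, c; split.
  have := gram_coordinates FE'; rewrite isoF -/c => /esym e.
  rewrite /s linearD linearZ /= [(c *m _)^T]trmx_mul trmxK.
  apply/matrixP => i j; move/matrixP/(_ i j): e; rewrite !mxE.
  set x := \sum_j0 _; set y := \sum_j0 _; set z := \sum_j0 _ => e.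
  have -> : y = - x - z by rewrite -[RHS]add0r -e; ring.
  by field.
rewrite -F_s /F; clearbody H; rewrite trmx_mul !mulmxA -[_ *m (invmx H)^T *m H^T]mulmxA -trmx_mul.
by rewrite mulmxV // trmx1 mulmx1 -[_ *m H *m invmx H]mulmxA mulmxV // mulmx1.
Qed.

End Chart.

Lemma witt_basis_exists (K : numClosedFieldType) w r n : n = (w + w + r)%N ->
  exists (E E' : 'M[K]_(w, n)) (Z : 'M[K]_(r, n)), witt_basis E E' Z.
Proof.
move=> ->; have ii : 'i * 'i = -1 :> K by rewrite -expr2 sqrCi.
have h1 : 2^-1 + 2^-1 = 1 :> K by field.
exists (row_mx (row_mx 1%:M 'i%:M) 0), (2^-1 *: row_mx (row_mx 1%:M (- 'i)%:M) 0).
exists (row_mx 0 1%:M).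
have tE (a : K) : (row_mx (row_mx 1%:M a%:M) 0 : 'M[K]_(w, w + w + r))^T =
    col_mx (col_mx 1%:M a%:M) 0.
  by rewrite !tr_row_mx !tr_scalar_mx trmx0.
have tZ : (row_mx 0 1%:M : 'M[K]_(r, w + w + r))^T = col_mx 0 1%:M.
  by rewrite tr_row_mx trmx0 trmx1.
have sD p (a b : K) : a%:M + b%:M = (a + b)%:M :> 'M_p by rewrite raddfD.
split; split; rewrite /isotropic ?linearZ /= ?tE ?tZ -?scalemxAl -?scalemxAr ?mul_row_col.
- by rewrite mul1mx -scalar_mxM ii mulmx0 addr0 sD subrr raddf0.
- by rewrite mul1mx -scalar_mxM mulrNN ii mulmx0 addr0 sD subrr raddf0 !scaler0.
- rewrite mul1mx -scalar_mxM mulrN ii opprK mulmx0 addr0 sD scale_scalar_mx.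
  by rewrite mulrDr mulr1 h1.
- by rewrite mul0mx add0r mul1mx.
- by rewrite mulmx0 mul0mx addr0.
- by rewrite mulmx0 mul0mx addr0 scaler0.
- rewrite !mul_col_row !mulmx0 !mul0mx !mulmx1 !mul1mx -!scalar_mxM.
  rewrite -scalerDr add_block_mx !addr0 add_block_mx !sD.
  rewrite mulrN ii opprK addNr addrN raddf0 scale_block_mx scale_block_mx !scaler0.
  rewrite !scale_scalar_mx !mulrDr mulr1 h1 add_block_mx !addr0 !add0r.
  by rewrite mulNr ii opprK mulr1 h1 -!scalar_mx_block.
Qed.

(** * The standard representatives *)

Lemma sympE (K : numFieldType) w (i j : 'I_w) a b x y :
  (x < 2)%N -> (y < 2)%N -> (i = 2 * a + x :> nat)%N -> (j = 2 * b + y :> nat)%N ->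
  (symp w : 'M[K]_w) i j = (a == b)%:R * (y%:R - x%:R).
Proof.
move=> x2 y2 ia jb; rewrite mxE.
have -> : ~~ odd i && (j == i.+1 :> nat) = [&& a == b, x == 0%N & y == 1%N] by lia.
have -> : ~~ odd j && (i == j.+1 :> nat) = [&& a == b, y == 0%N & x == 1%N] by lia.
by case: x x2 {ia} => [|[|]] // _; case: y y2 {jb} => [|[|]] // _; case: (a == b);
  rewrite /= ?subrr ?mulr0 ?mul0r ?mul1r.
Qed.

Section Representatives.
Context {R : realType}.
Local Notation C := R[i].
Variables n k : nat.
Hypothesis kn : (4 * k <= n)%N.

Let coef (e : nat) : C := nth 0 [:: 1; 1; 'i; - 'i] e.
Let pos (e : nat) : nat := nth 0%N [:: 0; 1; 1; 0]%N e.

(** Rows 2 and 3 of [block4] are ['i] times row 1 and [- 'i] times row 0, so that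
    a block is the form [symp 2] on an isotropic plane. *)
Definition block_frame : 'M[C]_(2 * k, n) := \matrix_(p, j)
  if (j < 4 * k)%N && (p == 2 * (j %/ 4) + pos (j %% 4) :> nat)%N
  then coef (j %% 4) else 0.

Lemma pos_lt2 e : (pos e < 2)%N.
Proof. by case: e => [|[|[|[|[]]]]]. Qed.

Lemma block_frame_col (j : 'I_n) : (j < 4 * k)%N ->
  exists p : 'I_(2 * k), (p = 2 * (j %/ 4) + pos (j %% 4) :> nat)%N /\
  forall q, block_frame q j = coef (j %% 4) * (q == p)%:R.
Proof.
move=> jk; have h : (2 * (j %/ 4) + pos (j %% 4) < 2 * k)%N.
  by have := pos_lt2 (j %% 4); lia.
exists (Ordinal h); split=> // q; rewrite mxE jk /=.
rewrite (_ : (q == Ordinal h) = (q == 2 * (j %/ 4) + pos (j %% 4) :> nat)%N) //.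
by case: ifP; rewrite ?mulr1 ?mulr0.
Qed.

Lemma block_frame_col0 (j : 'I_n) q : ~~ (j < 4 * k)%N -> block_frame q j = 0.
Proof. by move=> jk; rewrite mxE (negbTE jk). Qed.

Lemma Bmx_frame : Bmx R n k = block_frame^T *m symp (2 * k) *m block_frame.
Proof.
apply/matrixP => j l; rewrite mxE [RHS]mxE.
have [jk|jk] := boolP (j < 4 * k)%N; last first.
  rewrite big1 // => p _; rewrite mxE big1 ?mul0r // => q _.
  by rewrite mxE block_frame_col0 ?mul0r.
have [lk|lk] := boolP (l < 4 * k)%N; last first.
  rewrite big1 => [|p _]; last by rewrite block_frame_col0 ?mulr0.
  by case: eqP => // e; exfalso; move: lk jk e; rewrite -leqNgt; lia.
have [pj [pjE Fj]] := block_frame_col jk; have [pl [plE Fl]] := block_frame_col lk.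
rewrite (bigD1 pl) //= big1 ?addr0; last by move=> q /negbTE ql; rewrite Fl ql !mulr0.
rewrite [X in _ = X * _]mxE (bigD1 pj) //= big1 ?addr0; last first.
  by move=> q /negbTE qj; rewrite mxE Fj qj mulr0 mul0r.
rewrite [block_frame^T _ _]mxE Fj Fl !eqxx !mulr1 (sympE _ (pos_lt2 _) (pos_lt2 _) pjE plE).
case: eqP => [_|_]; last by rewrite mul0r mulr0 mul0r.
have ii : 'i * 'i = -1 :> C by rewrite -expr2 sqrCi.
rewrite mul1r mxE !inordK ?ltn_pmod //.
have := ltn_pmod l (isT : 0 < 4)%N; have := ltn_pmod j (isT : 0 < 4)%N.
rewrite /coef /pos.
case: (j %% 4)%N => [|[|[|[|e]]]] //; case: (l %% 4)%N => [|[|[|[|e']]]] //= _ _;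
 rewrite ?subrr ?subr0 ?sub0r ?mulr0 ?mul0r ?mulr1 ?mul1r ?mulrN1 ?mulrNN ?mulrN ?mulNr ?opprK ?ii ?mulN1r ?opprK ?mul1r //.
Qed.

Lemma block_frame_isotropic : isotropic block_frame.
Proof.
have ii : 'i * 'i = -1 :> C by rewrite -expr2 sqrCi.
apply/matrixP => p q; rewrite !mxE.
under eq_bigr do rewrite [X in _ * X]mxE.
have [<-|pq] := eqVneq p q; last first.
  rewrite big1 // => j _; have [jk|jk] := boolP (j < 4 * k)%N; last first.
    by rewrite block_frame_col0 ?mul0r.
  have [s [_ Fj]] := block_frame_col jk; rewrite !Fj.
  have [ps|] := eqVneq p s; last by rewrite mulr0 mul0r.
  by rewrite -ps eq_sym (negbTE pq) !mulr0.
have pk := ltn_ord p.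
pose e1 := if odd p then 1%N else 0%N; pose e2 := if odd p then 2%N else 3%N.
have h1 : (4 * (p %/ 2) + e1 < n)%N by rewrite /e1; case: (odd p); lia.
have h2 : (4 * (p %/ 2) + e2 < n)%N by rewrite /e2; case: (odd p); lia.
have val (e : nat) (h : (4 * (p %/ 2) + e < n)%N) : (e < 4)%N -> (p = 2 * (p %/ 2) + pos e :> nat)%N ->
    block_frame p (Ordinal h) = coef e.
  move=> e4 pe; rewrite mxE /=.
  have -> : ((4 * (p %/ 2) + e) %/ 4 = p %/ 2)%N by lia.
  have -> : ((4 * (p %/ 2) + e) %% 4 = e)%N by lia.
  by rewrite -pe eqxx andbT; case: ifP => // /negP[]; lia.
rewrite (bigD1 (Ordinal h1)) //= (bigD1 (Ordinal h2)) /=; last first.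
  by rewrite -val_eqE /= eqn_add2l /e1 /e2; case: (odd p).
rewrite (val _ h1) ?(val _ h2); try by rewrite /e1 /e2 /pos; case: ifP => /= op; lia.
rewrite big1 ?addr0; last first.
  move=> j /andP[]; rewrite -!val_eqE /= => j1 j2; rewrite mxE.
  case: ifP => [/andP[jk pj]|]; last by rewrite mul0r.
  exfalso; move: pj j1 j2; rewrite /e1 /e2 /pos; case: (boolP (odd p)) => op.
    have := ltn_pmod j (isT : 0 < 4)%N; have := divn_eq j 4.
    by case: (j %% 4)%N => [|[|[|[|e]]]] //=; lia.
  have := ltn_pmod j (isT : 0 < 4)%N; have := divn_eq j 4.
  by case: (j %% 4)%N => [|[|[|[|e]]]] //=; lia.
by rewrite /e1 /e2 /coef; case: (odd p); rewrite /= ?mulrNN ii mulr1 subrr.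
Qed.

Lemma block_frame_free : row_free block_frame.
Proof.
apply/row_freeP; exists (\matrix_(j, q) (j == 4 * (q %/ 2) + q %% 2 :> nat)%N%:R).
apply/matrixP => p q; rewrite !mxE; have qk := ltn_ord q.
have h : (4 * (q %/ 2) + q %% 2 < n)%N by lia.
rewrite (bigD1 (Ordinal h)) //= big1 ?addr0; last first.
  by move=> j jq; rewrite [X in _ * X]mxE (_ : (j == _ :> nat) = false) ?mulr0 // -(negbTE jq).
rewrite !mxE /= eqxx mulr1.
have -> : ((4 * (q %/ 2) + q %% 2) %/ 4 = q %/ 2)%N by lia.
have -> : ((4 * (q %/ 2) + q %% 2) %% 4 = q %% 2)%N by lia.
have e1 : (2 * (q %/ 2) + q %% 2 = q)%N by lia.
have e2 : pos (q %% 2) = (q %% 2)%N by rewrite modn2; case: odd.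
have e3 : coef (q %% 2) = 1 by rewrite modn2; case: odd.
have -> : (4 * (q %/ 2) + q %% 2 < 4 * k)%N by lia.
by rewrite e2 e1 e3 /=; case: (p =P q) => [->|pq]; rewrite ?eqxx //; case: eqP => // /val_inj.
Qed.

Theorem Bmx_stratum : stratum (2 * k) (Bmx R n k).
Proof.
rewrite Bmx_frame; apply: symp_stratum block_frame_isotropic block_frame_free _.
by rewrite mul2n odd_double.
Qed.

End Representatives.

(** * The dimension of projective space *)

Lemma line_scale (K : fieldType) (V : vectType K) a (v : V) :
  a != 0 -> <[a *: v]>%VS = <[v]>%VS.
Proof.
move=> a0; apply/eqP; rewrite eqEsubv -!memvE memvZ ?memv_line //=.
by rewrite -[v in v \in _](scalerK a0) memvZ // memv_line.
Qed.

Section ProjectiveSpace.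
Context {K : numFieldType} {V : vectType K}.

Let b (i : 'I_(\dim {:V})) : V := (vbasis {:V})`_i.

Definition affine_chart (i0 : 'I_(\dim {:V})) (x : 'rV[K]_(\dim {:V}).-1) : V :=
  b i0 + \sum_j x 0 j *: b (lift i0 j).

Lemma coord_b i j : coords (b j) i = (i == j)%:R.
Proof. by rewrite /coords /b coord_free ?(basis_free (vbasisP _)) // eq_sym. Qed.

Lemma coord_affine_chart i0 x : coords (affine_chart i0 x) i0 = 1.
Proof.
rewrite /affine_chart /coords linearD linear_sum /= -!/(coords _ _) coord_b eqxx.
rewrite big1 ?addr0 // => j _; rewrite linearZ /= -/(coords _ _) coord_b.
by rewrite (negbTE (neq_lift _ _)) mulr0.
Qed.

Lemma coord_affine_chart_lift i0 x j : coords (affine_chart i0 x) (lift i0 j) = x 0 j.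
Proof.
rewrite /affine_chart /coords linearD linear_sum /= -!/(coords _ _) coord_b.
rewrite eq_sym (negbTE (neq_lift _ _)) add0r.
rewrite (bigD1 j) //= big1 ?addr0; last first.
  move=> k kj; rewrite linearZ /= -/(coords _ _) coord_b (inj_eq lift_inj).
  by rewrite eq_sym (negbTE kj) mulr0.
by rewrite linearZ /= -/(coords _ _) coord_b eqxx mulr1.
Qed.

Lemma poly_map_affine_chart i0 : poly_map 1 (affine_chart i0).
Proof.
move=> i; apply: (@line_poly_eq _ _ _ (fun x : 'rV[K]_(\dim {:V}).-1 => coords (b i0) i +
    \sum_j x 0 j * coords (b (lift i0 j)) i)).
  move=> x; rewrite /affine_chart /coords linearD linear_sum; congr (_ + _).
  by apply: eq_bigr => j _; rewrite linearZ.
apply: line_polyD; first exact: line_poly_const.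
apply: line_poly_sum => j; apply: (@line_polyM _ _ 1 0) (line_poly_const _ _).
by apply: line_poly_lin => a x y; rewrite !mxE.
Qed.

Lemma affine_chart_surj i0 v : coords v i0 != 0 ->
  exists x, v = coords v i0 *: affine_chart i0 x.
Proof.
move=> v0; exists (\row_j (coords v (lift i0 j) / coords v i0)).
rewrite [LHS](coord_vbasis (memvf v)) (bigD1_ord i0) //= /affine_chart scalerDr.
rewrite scaler_sumr; congr (_ + _); apply: eq_bigr => j _.
by rewrite mxE scalerA mulrC divfK.
Qed.

(** The standard affine charts of projective space. *)
Theorem krull_dim_projspace : (0 < \dim {:V})%N ->
  krull_dim [set: projspace V] (\dim {:V}).-1.
Proof.
move=> V0; pose i0 := Ordinal V0.
have chart0 i x : affine_chart i x != 0.
  apply/eqP => e; have := coord_affine_chart i x; rewrite e /coords linear0 => /eqP.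
  by rewrite eq_sym oner_eq0.
split.
  apply: (@chart_chain _ _ _ _ 1 0 (affine_chart i0) (fun=> 1)).
  - exact: poly_map_affine_chart.
  - exact: line_poly_const.
  - exact: oner_neq0.
  - by [].
  - move=> j; exists 1%N, (fun v => coords v (lift i0 j)); split.
      exact/hform_lin/coords_scalar.
    by move=> x _; rewrite coord_affine_chart_lift.
apply: chain_length_le => L _.
have [v v0 Lv] := projspace_gen L; have [i vi] := exists_coord v0.
have fi : hform 1 (fun u : V => coords u i) by exact/hform_lin/coords_scalar.
exists (zeros (fun u => coords u i)), 1%N, (affine_chart i); split.
- exact: closed_zeros fi.
- by move/(zerosP fi Lv)/eqP; apply/negP.
- exact: poly_map_affine_chart.
- move=> M _ nM; have [u u0 Mu] := projspace_gen M.
  have ui : coords u i != 0 by apply/eqP => ui; apply: nM; apply/(zerosP fi Mu).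
  have [x ux] := affine_chart_surj ui; exists x.
  by rewrite Mu ux line_scale.
Qed.

End ProjectiveSpace.

(** * Algebras of functions *)

Section FunctionAlgebras.
Context {K : fieldType} {U : lmodType K}.

(** Stability under polynomial expressions, shared by the functions that are
    polynomial along lines and by those that are polynomial on a chart. *)
Definition fun_algebra (P : (U -> K) -> Prop) :=
  [/\ forall c, P (fun=> c), forall f g, P f -> P g -> P (fun u => f u + g u) &
      forall f g, P f -> P g -> P (fun u => f u * g u)].

Variable P : (U -> K) -> Prop.
Hypothesis algP : fun_algebra P.

Definition mx_fun a b (M : U -> 'M[K]_(a, b)) := forall i j, P (fun u => M u i j).

Lemma fun_algebra_sum (I : Type) (s : seq I) (Q : pred I) (F : I -> U -> K) :
  (forall i, P (F i)) -> P (fun u => \sum_(i <- s | Q i) F i u).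
Proof.
have [c d _] := algP; move=> hF; elim: s => [|i s IH].
  by under eq_fun do rewrite big_nil; exact: c.
by under eq_fun do rewrite big_cons; case: (Q i) => //; exact: d.
Qed.

Lemma fun_algebra_prod (I : Type) (s : seq I) (F : I -> U -> K) :
  (forall i, P (F i)) -> P (fun u => \prod_(i <- s) F i u).
Proof.
have [c _ m] := algP; move=> hF; elim: s => [|i s IH].
  by under eq_fun do rewrite big_nil; exact: c.
by under eq_fun do rewrite big_cons; exact: m.
Qed.

Lemma mx_fun_const a b (M : 'M[K]_(a, b)) : mx_fun (fun=> M).
Proof. by move=> i j; have [c _ _] := algP; exact: c. Qed.

Lemma mx_funD a b (M N : U -> 'M[K]_(a, b)) :
  mx_fun M -> mx_fun N -> mx_fun (fun u => M u + N u).
Proof.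
have [_ d _] := algP; move=> hM hN i j.
by under eq_fun do rewrite mxE; apply: d.
Qed.

Lemma mx_funZ a b (f : U -> K) (M : U -> 'M[K]_(a, b)) :
  P f -> mx_fun M -> mx_fun (fun u => f u *: M u).
Proof.
have [_ _ m] := algP; move=> hf hM i j.
by under eq_fun do rewrite mxE; apply: m.
Qed.

Lemma mx_funT a b (M : U -> 'M[K]_(a, b)) : mx_fun M -> mx_fun (fun u => (M u)^T).
Proof. by move=> hM i j; under eq_fun do rewrite mxE; apply: hM. Qed.

Lemma mx_funM a b c (M : U -> 'M[K]_(a, b)) (N : U -> 'M[K]_(b, c)) :
  mx_fun M -> mx_fun N -> mx_fun (fun u => M u *m N u).
Proof.
have [_ _ m] := algP; move=> hM hN i j.
by under eq_fun do rewrite mxE; apply: fun_algebra_sum => k; apply: m.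
Qed.

Lemma fun_det a (M : U -> 'M[K]_a) : mx_fun M -> P (fun u => \det (M u)).
Proof.
have [c _ m] := algP; move=> hM; apply: fun_algebra_sum => s.
by apply: m; [exact: c|apply: fun_algebra_prod => i; exact: hM].
Qed.

Lemma mx_fun_adj a (M : U -> 'M[K]_a) : mx_fun M -> mx_fun (fun u => \adj (M u)).
Proof.
have [c _ m] := algP; move=> hM i j; under eq_fun do rewrite mxE.
apply: m; first exact: c; apply: fun_det => k l.
by under eq_fun do rewrite !mxE; exact: hM.
Qed.

End FunctionAlgebras.

Section PolynomialFunctions.
Context {K : fieldType} {U : lmodType K}.

Definition poly_fun (f : U -> K) := exists D, line_poly D f.

Lemma poly_fun_algebra : fun_algebra poly_fun.
Proof.
split=> [c|f g [D hf] [D' hg]|f g [D hf] [D' hg]].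
- by exists 0%N; exact: line_poly_const.
- exists (maxn D D'); apply: line_polyD; first exact: line_poly_le (leq_maxl _ _) hf.
  exact: line_poly_le (leq_maxr _ _) hg.
- by exists (D + D')%N; exact: line_polyM.
Qed.

Lemma poly_fun_lin (l : U -> K) : scalar l -> poly_fun l.
Proof. by move=> hl; exists 1%N; exact: line_poly_lin. Qed.

Lemma poly_mapP {V : vectType K} (psi : U -> V) :
  (forall i, poly_fun (fun u => coords (psi u) i)) -> exists D, poly_map D psi.
Proof.
move=> h; have [D hD] := choice h; exists (\max_i D i)%N => i.
exact: line_poly_le (leq_bigmax _) (hD i).
Qed.

Definition chart_fun {V : vectType K} (psi : U -> V) (h : U -> K) :=
  exists d f, hform d f /\ forall u, f (psi u) = h u.

(** Powers of the linear form [t], equal to 1 on the chart, make degrees agree. *)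
Lemma chart_fun_algebra {V : vectType K} (psi : U -> V) (t : V -> K) :
  hform 1 t -> (forall u, t (psi u) = 1) -> fun_algebra (chart_fun psi).
Proof.
move=> ht t1; split=> [c|f g [d [p [hp ep]]] [d' [q [hq eq]]]|f g [d [p [hp ep]]] [d' [q [hq eq]]]].
- by exists 0%N, (fun=> c); split=> //; exact: hform_const.
- exists (d + d')%N, (fun v => p v * t v ^+ d' + t v ^+ d * q v); split.
    by apply: hformD; apply: hformM => //; rewrite -[X in hform X]mul1n; exact: hformX.
  by move=> u; rewrite t1 !expr1n mulr1 mul1r ep eq.
- exists (d + d')%N, (fun v => p v * q v); split; first exact: hformM.
  by move=> u; rewrite ep eq.
Qed.

End PolynomialFunctions.

Lemma hform_prod1 (K : fieldType) (V : vectType K) (I : Type) (s : seq I) (F : I -> V -> K) :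
  (forall i, hform 1 (F i)) -> hform (size s) (fun v => \prod_(i <- s) F i v).
Proof.
move=> hF; elim: s => [|i s IH].
  by apply: hform_eq (hform_const 1) => v; rewrite big_nil.
by apply: hform_eq (hformM (hF i) IH) => v; rewrite big_cons.
Qed.

Lemma hform_det (K : fieldType) (V : vectType K) a (M : V -> 'M[K]_a) :
  (forall i j, hform 1 (fun v => M v i j)) -> hform a (fun v => \det (M v)).
Proof.
move=> hM; apply: hform_sum => s; apply: hformZ.
have := @hform_prod1 _ V _ (index_enum 'I_a) (fun i v => M v i (s i)).
have -> : size (index_enum 'I_a) = a by rewrite -[RHS]card_ord cardT enumT.
by apply=> i; exact: hM.
Qed.

(** * The dimension of the strata *)

Lemma linear_inj_dim (K : fieldType) (V W : vectType K) (f : V -> W) :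
  linear f -> injective f -> (dim V <= dim W)%N.
Proof.
move=> lf inj; pose g : {linear V -> W} := HB.pack f (GRing.isLinear.Build K V W *:%R f lf).
have k0 : lker (linfun g) == 0%VS.
  by apply/lker0P => u v; rewrite !lfunE; exact: inj.
rewrite -(dimvf V) -(dimvf W) -(limg_dim_eq (f := linfun g) (U := fullv)).
  exact: dimvS (subvf _).
by rewrite (eqP k0) capv0.
Qed.

Lemma dim_prod (K : fieldType) (V W : vectType K) : dim (V * W)%type = (dim V + dim W)%N.
Proof. by []. Qed.

Section SkewSpace.
Context {R : realType}.
Local Notation C := R[i].
Local Notation skewmx := (@Defs.skewmx R).

Lemma skew_val n (X : skewmx n) : (vsval X)^T = - vsval X.
Proof. by apply/skewvP; exact: subvsP. Qed.

Definition to_skew n (M : 'M[C]_n) : skewmx n := vsproj (skewv n) M.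

Lemma to_skewK n (M : 'M[C]_n) : M^T = - M -> vsval (to_skew M) = M.
Proof. by move=> hM; apply: vsprojK; apply/skewvP. Qed.

Lemma val_to_skew n (X : skewmx n) : to_skew (vsval X) = X.
Proof. exact: vsvalK. Qed.

Lemma to_skew_linear n : linear (@to_skew n).
Proof. exact: linearP. Qed.

(** Removing the first row and column of a skew matrix leaves a row vector and a
    smaller skew matrix. *)
Lemma dim_skewmx n : dim (skewmx n) = 'C(n, 2).
Proof.
elim: n => [|n IH].
  apply/eqP; rewrite -leqn0; apply: leq_trans (_ : dim 'M[C]_0 <= 0)%N; last by [].
  by apply: (@linear_inj_dim _ _ _ (fun X : skewmx 0 => vsval X)); [exact: linearP|exact: val_inj].
rewrite binS bin1 addnC -IH; apply/eqP; rewrite eqn_leq; apply/andP; split.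
  have -> : (n + dim (skewmx n) = dim ('rV[C]_n * skewmx n)%type)%N.
    by rewrite dim_prod (_ : dim 'rV[C]_n = n) // dim_matrix -[LHS]/(1 * n)%N mul1n.
  pose f (X : skewmx n.+1) := (ursubmx (vsval X : 'M[C]_(1 + n)),
    to_skew (drsubmx (vsval X : 'M[C]_(1 + n)))).
  apply: (@linear_inj_dim _ _ _ f).
    move=> a X Y; congr pair; first by apply/matrixP => i j; rewrite !mxE.
    rewrite -[RHS](to_skew_linear a); congr to_skew.
    by apply/matrixP => i j; rewrite !mxE.
  move=> X Y [eu ed]; apply: val_inj; rewrite /=.
  have skd (Z : skewmx n.+1) : (drsubmx (vsval Z : 'M[C]_(1 + n)))^T = - drsubmx (vsval Z : 'M[C]_(1 + n)).
    by rewrite trmx_drsub skew_val; apply/matrixP => i j; rewrite !mxE.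
  have {}ed := congr1 vsval ed; rewrite !to_skewK // in ed.
  rewrite -[vsval X](@submxK _ 1 n 1 n) -[vsval Y](@submxK _ 1 n 1 n) eu ed.
  have ul (Z : skewmx n.+1) : ulsubmx (vsval Z : 'M[C]_(1 + n)) = 0.
    apply/matrixP => i j; rewrite !ord1 !mxE; apply: skew_diag; exact: skew_val.
  have dl (Z : skewmx n.+1) : dlsubmx (vsval Z : 'M[C]_(1 + n)) = - (ursubmx (vsval Z : 'M[C]_(1 + n)))^T.
    by rewrite trmx_ursub skew_val; apply/matrixP => i j; rewrite !mxE opprK.
  by rewrite !ul !dl eu.
have -> : (n + dim (skewmx n) = dim ('rV[C]_n * skewmx n)%type)%N.
  by rewrite dim_prod (_ : dim 'rV[C]_n = n) // dim_matrix -[LHS]/(1 * n)%N mul1n.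
pose M (p : 'rV[C]_n * skewmx n) : 'M[C]_(1 + n) := block_mx 0 p.1 (- p.1^T) (vsval p.2).
have hM p : (M p)^T = - M p.
  by rewrite /M tr_block_mx linearN /= trmxK trmx0 skew_val opp_block_mx oppr0 opprK.
apply: (@linear_inj_dim _ _ _ (fun p => to_skew (M p : 'M[C]_n.+1))).
  move=> a p q; rewrite -to_skew_linear; congr to_skew.
  apply/matrixP => i j; rewrite !mxE.
  case: (@split 1 n i) => {}i; rewrite !mxE; case: (@split 1 n j) => {}j; rewrite !mxE //.
    by rewrite mulr0 addr0.
  by rewrite mulrN -opprD.
move=> p q /(congr1 vsval); rewrite !to_skewK // => e.
have e' : M p = M q := e; have [_ e1 _ e2] := eq_block_mx e'.
by case: p q e1 e2 {e e'} => [p1 p2] [q1 q2] /= -> /val_inj ->.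
Qed.

End SkewSpace.

Section OrbitChart.
Import VectorInternalTheory.
Context {R : realType} {n w r : nat}.
Local Notation C := R[i].
Local Notation skewmx := (@Defs.skewmx R).
Variables (E E' : 'M[C]_(w, n)) (Z : 'M[C]_(r, n)) (i0 i1 : 'I_w).
Hypotheses (basis : witt_basis E E' Z) (w_even : ~~ odd w).
Hypothesis symp01 : (symp w : 'M[C]_w) i0 i1 = 1.

Definition entry (S : skewmx w) : C^o := vsval S i0 i1.

Lemma entry_linear : linear entry.
Proof. by move=> a S T; rewrite /entry linearP !mxE. Qed.

Definition entry_lin : {linear skewmx w -> C^o} :=
  HB.pack entry (GRing.isLinear.Build C (skewmx w) C^o *:%R entry entry_linear).

Definition entry_ker : {vspace skewmx w} := lker (linfun entry_lin).

Lemma mem_entry_ker S : (S \in entry_ker) = (vsval S i0 i1 == 0).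
Proof. by rewrite memv_ker lfunE. Qed.

Lemma dim_entry_ker : \dim entry_ker = 'C(w, 2).-1.
Proof.
have h := limg_ker_dim (linfun entry_lin) fullv.
rewrite capfv dimvf dim_skewmx in h.
suff e : \dim (linfun entry_lin @: fullv) = 1%N by rewrite -h e addn1.
apply/eqP; rewrite eqn_leq; apply/andP; split.
  by apply: leq_trans (dimvS (subvf _)) _; rewrite dimvf.
rewrite lt0n dimv_eq0; apply/eqP => im0.
have : linfun entry_lin (to_skew (symp w)) \in 0%VS.
  by rewrite -im0 memv_img // memvf.
rewrite memv0 lfunE /= /entry to_skewK ?tr_symp // symp01; exact/negP/oner_neq0.
Qed.

(** Up to scaling the entry of [S] at [(i0, i1)] is 1, so that the square-zero
    matrices of the chart are given by [S - symp w] in [entry_ker] and by the two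
    coordinates of an isotropic subspace. *)
Definition chart_dom : vectType C := (subvs_of entry_ker * skewmx w * 'M[C]_(w, r))%type.

Lemma dim_chart_dom : dim chart_dom = ('C(w, 2).-1 + 'C(w, 2) + w * r)%N.
Proof. by rewrite !dim_prod dim_skewmx -dim_entry_ker. Qed.

Definition chart_form (u : chart_dom) : 'M[C]_w := symp w + vsval (vsval u.1.1).
Definition chart_fr (u : chart_dom) := chart_frame E E' Z (vsval u.1.2) u.2.
Definition chart_mx (u : chart_dom) : 'M[C]_n :=
  (chart_fr u)^T *m chart_form u *m chart_fr u.

Lemma chart_form_skew u : (chart_form u)^T = - chart_form u.
Proof. by rewrite linearD /= tr_symp skew_val opprD. Qed.

Lemma chart_form01 u : chart_form u i0 i1 = 1.
Proof.
rewrite mxE symp01; have := subvsP u.1.1; rewrite mem_entry_ker => /eqP ->.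
by rewrite addr0.
Qed.

Lemma chart_mx_skew u : (chart_mx u)^T = - chart_mx u.
Proof. exact/skew_sandwich/chart_form_skew. Qed.

Lemma chart_mx_stratum u : \det (chart_form u) != 0 -> stratum w (chart_mx u).
Proof.
move=> du; exists (chart_fr u), (chart_form u); split=> //.
- exact: (chart_frame_isotropic basis _ (skew_val _)).
- exact: (chart_frame_free basis).
- exact: chart_form_skew.
Qed.

Lemma chart_mx_E'E' u : E' *m chart_mx u *m E'^T = chart_form u.
Proof.
have d := chart_frame_dual basis (vsval u.1.2) u.2.
rewrite /chart_mx !mulmxA -[_ *m chart_fr u *m E'^T]mulmxA d mulmx1.
have /(congr1 trmx) := d; rewrite trmx_mul trmxK trmx1 => d'.
by rewrite d' mul1mx.
Qed.

Lemma chart_mx_E'E u : E' *m chart_mx u *m E^T =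
  chart_form u *m (vsval u.1.2 - 2^-1 *: (u.2 *m u.2^T)).
Proof.
have /(congr1 trmx) := chart_frame_dual basis (vsval u.1.2) u.2.
rewrite trmx_mul trmxK trmx1 => d'.
rewrite -(chart_frame_E basis) /chart_mx !mulmxA d' mul1mx.
by rewrite -mulmxA.
Qed.

Lemma chart_mx_E'Z u : E' *m chart_mx u *m Z^T = chart_form u *m u.2.
Proof.
have /(congr1 trmx) := chart_frame_dual basis (vsval u.1.2) u.2.
rewrite trmx_mul trmxK trmx1 => d'.
rewrite -[in RHS](chart_frame_Z basis (vsval u.1.2) u.2) /chart_mx !mulmxA d' mul1mx.
by rewrite -mulmxA.
Qed.

Lemma poly_chart_form : mx_fun poly_fun chart_form.
Proof.
apply: (mx_funD poly_fun_algebra); first exact: (mx_fun_const poly_fun_algebra).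
by move=> i j; apply: poly_fun_lin => a u v; rewrite !linearP !mxE.
Qed.

Lemma poly_chart_mx : mx_fun poly_fun chart_mx.
Proof.
have alg : fun_algebra (@poly_fun _ chart_dom) := poly_fun_algebra.
have hs : mx_fun poly_fun (fun u : chart_dom => vsval u.1.2).
  by move=> i j; apply: poly_fun_lin => a u v; rewrite !linearP !mxE.
have hc : mx_fun poly_fun (fun u : chart_dom => u.2).
  by move=> i j; apply: poly_fun_lin => a u v; rewrite !mxE.
have hf : mx_fun poly_fun chart_fr.
  apply: (mx_funD alg); last exact: (mx_funM alg hc (mx_fun_const alg Z)).
  apply: (mx_funD alg); first exact: (mx_fun_const alg).
  apply: (mx_funM alg); last exact: (mx_fun_const alg).
  have hcc : mx_fun poly_fun (fun u : chart_dom => (- 2^-1) *: (u.2 *m u.2^T)).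
    apply: (mx_funZ alg (f := fun=> - 2^-1)); first by have [c _ _] := alg; exact: c.
    exact: (mx_funM alg hc (mx_funT hc)).
  have := mx_funD alg hs hcc; congr mx_fun; apply/funext => u.
  by rewrite scaleNr.
exact: (mx_funM alg (mx_funM alg (mx_funT hf) poly_chart_form) hf).
Qed.

Lemma skew_functional m (l : skewmx m -> C) X : scalar l ->
  l X = \sum_i \sum_j vsval X i j * l (to_skew (delta_mx i j)).
Proof.
move=> hl; pose L : {linear skewmx m -> C^o} :=
  HB.pack (l : skewmx m -> C^o) (GRing.isLinear.Build C (skewmx m) C^o *:%R l hl).
rewrite -[LHS]/(L X) -{1}(val_to_skew X) {1}(matrix_sum_delta (vsval X)).
rewrite /to_skew !linear_sum; apply: eq_bigr => i _.
by rewrite !linear_sum; apply: eq_bigr => j _; rewrite !linearZ.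
Qed.

Definition chart_map (Q : 'M[C]_n) (u : chart_dom) : skewmx n :=
  to_skew (Q^T *m chart_mx u *m Q).

Lemma chart_map_val Q u : vsval (chart_map Q u) = Q^T *m chart_mx u *m Q.
Proof. exact/to_skewK/skew_sandwich/chart_mx_skew. Qed.

Lemma poly_chart_map Q : exists D, poly_map D (chart_map Q).
Proof.
have alg : fun_algebra (@poly_fun _ chart_dom) := poly_fun_algebra.
have hM : mx_fun poly_fun (fun u => vsval (chart_map Q u)).
  under eq_fun do rewrite chart_map_val.
  exact: (mx_funM alg (mx_funM alg (mx_fun_const alg _) poly_chart_mx) (mx_fun_const alg Q)).
apply: poly_mapP => i.
under eq_fun do rewrite (skew_functional _ (coords_scalar i)).
apply: (fun_algebra_sum alg) => j; apply: (fun_algebra_sum alg) => k.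
by have [c _ m] := alg; apply: m; [exact: hM|exact: c].
Qed.

(** The blocks of a matrix in the chart are the form, and its products with [c]
    and with [s - 2^-1 *: (c *m c^T)]. Dividing by the form once yields [c], and
    [s] takes a second division because of the quadratic term. *)
Lemma chart_coordinates : let P := chart_fun (chart_map 1%:M) in
  forall l : chart_dom -> C, scalar l ->
  P (fun u => \det (chart_form u) ^+ 2 * l u).
Proof.
move=> P l hl.
have val1 u : vsval (chart_map 1%:M u) = chart_mx u.
  by rewrite chart_map_val trmx1 mul1mx mulmx1.
have entry_form (A : 'M[C]_(w, n)) m (B : 'M[C]_(n, m)) i j :
    hform 1 (fun X : skewmx n => (A *m vsval X *m B) i j).
  apply: hform_lin => a X Y.
  have -> : vsval (a *: X + Y) = a *: vsval X + vsval Y by exact: linearP.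
  by rewrite mulmxDr mulmxDl -scalemxAr -scalemxAl [LHS]mxE; congr (_ + _); rewrite mxE.
have alg : fun_algebra P.
  apply: (chart_fun_algebra (entry_form E' _ E'^T i0 i1)) => u.
  by rewrite val1 chart_mx_E'E' chart_form01.
have [cst add mul] := alg.
have entry_fun m (B : 'M[C]_(n, m)) : mx_fun P (fun u => E' *m chart_mx u *m B).
  move=> i j; exists 1%N; eexists; split; first exact: (entry_form E' _ B i j).
  by move=> u /=; rewrite val1.
have hS : mx_fun P chart_form.
  by have := entry_fun _ E'^T; under eq_fun do rewrite chart_mx_E'E'.
have hadj := mx_fun_adj alg hS.
pose d u := \det (chart_form u).
have hd : P d by exact: fun_det.
have hc : mx_fun P (fun u => d u *: u.2).
  have := mx_funM alg hadj (entry_fun _ Z^T).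
  by under eq_fun do rewrite chart_mx_E'Z mulmxA mul_adj_mx mul_scalar_mx.
have ha : mx_fun P (fun u => d u *: (vsval u.1.2 - 2^-1 *: (u.2 *m u.2^T))).
  have := mx_funM alg hadj (entry_fun _ E^T).
  by under eq_fun do rewrite chart_mx_E'E mulmxA mul_adj_mx mul_scalar_mx.
have hs : mx_fun P (fun u => d u ^+ 2 *: vsval u.1.2).
  have := mx_funD alg (mx_funZ alg hd ha)
    (mx_funZ alg (cst 2^-1) (mx_funM alg hc (mx_funT hc))).
  congr mx_fun; apply/funext => u.
  rewrite [(_ *: u.2)^T]linearZ /= -scalemxAl -scalemxAr !scalerA.
  by rewrite -mulrA [2^-1 * _]mulrC expr2 scalerBr scalerA subrK.
have hs0 : mx_fun P (fun u => vsval (vsval u.1.1)).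
  have := mx_funD alg hS (mx_fun_const alg (- symp w)).
  by under eq_fun do rewrite /chart_form addrC addrA addNr add0r.
pose l0 (S : subvs_of entry_ker) := l ((S, 0), 0).
pose l1 (S : skewmx w) := l ((0, S), 0).
pose l2 (c : 'M[C]_(w, r)) := l ((0, 0), c).
have lE u : l u = l0 u.1.1 + l1 u.1.2 + l2 u.2.
  have lD x y : l (x + y) = l x + l y by have := hl 1 x y; rewrite scale1r mul1r.
  rewrite /l0 /l1 /l2 -!lD; congr l; case: u => [[a b] c].
  by congr pair; [congr pair|]; rewrite /= ?addr0 ?add0r.
have hl0 : scalar l0.
  by move=> a x y; rewrite /l0 -hl; congr l; congr pair; try congr pair; rewrite /= ?scaler0 ?addr0.
have hl1 : scalar l1.
  by move=> a x y; rewrite /l1 -hl; congr l; congr pair; try congr pair; rewrite /= ?scaler0 ?addr0.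
have hl2 : scalar l2.
  by move=> a x y; rewrite /l2 -hl; congr l; congr pair; try congr pair; rewrite /= ?scaler0 ?addr0.
suff [h0 h1 h2] : [/\ P (fun u => d u ^+ 2 * l0 u.1.1), P (fun u => d u ^+ 2 * l1 u.1.2)
    & P (fun u => d u ^+ 2 * l2 u.2)].
  have := add _ _ (add _ _ h0 h1) h2; congr P; apply/funext => u.
  by rewrite lE !mulrDr.
have comb a b (M : chart_dom -> 'M[C]_(a, b)) (c : 'I_a -> 'I_b -> C) (h : chart_dom -> C) :
    mx_fun P (fun u => d u ^+ 2 *: M u) -> (forall u, h u = \sum_i \sum_j M u i j * c i j) ->
    P (fun u => d u ^+ 2 * h u).
  move=> hM hE; under eq_fun do rewrite hE mulr_sumr.
  apply: (fun_algebra_sum alg) => i; under eq_fun do rewrite mulr_sumr.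
  apply: (fun_algebra_sum alg) => j; under eq_fun do rewrite mulrA.
  apply: mul (cst _).
  by have := hM i j; under eq_fun do rewrite mxE.
have hd2 : P (fun u => d u ^+ 2) by under eq_fun do rewrite expr2; exact: mul.
split.
- apply: (comb _ _ _ _ _ (mx_funZ alg hd2 hs0)) => u.
  rewrite -[u.1.1 in LHS]vsvalK.
  apply: (@skew_functional _ (l0 \o @vsproj C (skewmx w) entry_ker)) => a x y /=.
  by rewrite linearP hl0.
- by apply: (comb _ _ _ _ _ hs) => u; exact: skew_functional.
- apply: (comb _ _ (fun u => u.2) (fun i j => l2 (delta_mx i j))).
    have := mx_funZ alg hd hc.
    by under eq_fun do rewrite scalerA -expr2.
  move=> u; pose L : {linear 'M[C]_(w, r) -> C^o} :=
    HB.pack (l2 : 'M[C]_(w, r) -> C^o) (GRing.isLinear.Build C 'M[C]_(w, r) C^o *:%R l2 hl2).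
  rewrite -[LHS]/(L u.2) (matrix_sum_delta u.2) linear_sum; apply: eq_bigr => i _.
  by rewrite linear_sum; apply: eq_bigr => j _; rewrite linearZ -matrix_sum_delta.
Qed.

Definition stratum_points : set (projspace (skewmx n)) :=
  [set L : projspace (skewmx n) |
    exists X : skewmx n, stratum w (vsval X) /\ val L = <[X]>%VS].

Lemma poly_map_r2v (V : vectType C) D (psi : chart_dom -> V) :
  poly_map D psi -> poly_map D (psi \o @r2v _ chart_dom).
Proof.
move=> h i x y; have [P sP e] := h i (r2v x) (r2v y); exists P => // t.
by rewrite -e /= linearD linearZ.
Qed.

Lemma chart_covers Q (Y : skewmx n) : Q^T *m Q = 1%:M -> stratum w (vsval Y) ->
  let S := E' *m (Q *m vsval Y *m Q^T) *m E'^T in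
  \det S != 0 -> S i0 i1 != 0 -> exists a u, a != 0 /\ Y = a *: chart_map Q u.
Proof.
move=> hQ hY S dS S01; have hQ' : Q *m Q^T = 1%:M by exact: mulmx1C.
have strX : stratum w (Q *m vsval Y *m Q^T).
  by have := @stratum_conj _ _ w _ Q^T _ hY; rewrite trmxK; apply.
have uS : S \in unitmx by rewrite unitmxE unitfE.
have [s [c [hs XE]]] := chart_surjective basis strX uS.
have hS : S^T = - S by apply: skew_congr; exact: stratum_skew strX.
pose a := S i0 i1; pose T := a^-1 *: S - symp w.
have hT : T^T = - T.
  by rewrite /T linearB linearZ /= hS tr_symp scalerN opprB opprK addrC.
have T0 : to_skew T \in entry_ker.
  by rewrite mem_entry_ker to_skewK // /T mxE [(- symp w) _ _]mxE symp01 mxE mulVf // subrr.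
exists a, ((vsproj entry_ker (to_skew T), to_skew s), c); split=> //.
apply: val_inj; rewrite -[RHS]/(vsval _) linearZ /= chart_map_val.
rewrite /chart_mx /chart_form /chart_fr /= !to_skewK // vsprojK // to_skewK //.
rewrite /T addrC subrK -scalemxAr -scalemxAl -scalemxAr -scalemxAl scalerA mulfV // scale1r.
by rewrite -XE !mulmxA hQ mul1mx -mulmxA hQ mulmx1.
Qed.

(** By transitivity, translates of the chart at [E] cover the stratum. *)
Theorem krull_dim_stratum : krull_dim stratum_points (dim chart_dom).
Proof.
have w0 : (0 < w)%N by exact: leq_ltn_trans (leq0n i0) (ltn_ord i0).
have dsymp : \det (symp w : 'M[C]_w) != 0 by rewrite -unitfE -unitmxE symp_unit.
have form0 : chart_form 0 = symp w by rewrite /chart_form (_ : (0 : chart_dom).1.1 = 0) // !linear0 addr0.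
split.
  have [D hD] := poly_chart_map 1%:M.
  have [Dg hDg] := fun_det poly_fun_algebra poly_chart_form.
  apply: (@chart_chain _ _ _ _ D Dg _ (fun x => \det (chart_form (r2v x)))
    (poly_map_r2v hD)).
  - move=> x y; have [P sP e] := hDg (r2v x) (r2v y); exists P => // t.
    by rewrite -e /= linearD linearZ.
  - by rewrite linear0 form0.
  - move=> x /chart_mx_stratum str; have str' : stratum w (vsval (chart_map 1%:M (r2v x))).
      by rewrite chart_map_val trmx1 mul1mx mulmx1.
    split; last by move=> L Lx; exists (chart_map 1%:M (r2v x)).
    by apply: contraTneq (stratum_neq0 w0 str') => /= ->; rewrite linear0 eqxx.
  - move=> i; have hl : scalar (fun u : chart_dom => v2r u 0 i : C).
      by move=> a u v; rewrite linearP !mxE.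
    have [d [f [hf fE]]] := chart_coordinates hl.
    exists d, f; split=> // x gx; rewrite /= fE r2vK; split=> [/eqP|->]; last by rewrite mulr0.
    by rewrite mulf_eq0 expf_eq0 (negbTE gx) /= => /eqP.
apply: chain_length_le => L [Y [strY LY]].
have str0 : stratum w (chart_mx 0) by apply: chart_mx_stratum; rewrite form0.
have [Q hQ YE] := stratum_transitive str0 strY.
have hQ' : Q *m Q^T = 1%:M by exact: mulmx1C.
pose S (Y : skewmx n) := E' *m (Q *m vsval Y *m Q^T) *m E'^T.
have lS i j : hform 1 (fun Y => S Y i j).
  apply: hform_lin => a X X'; rewrite /S.
  have -> : vsval (a *: X + X') = a *: vsval X + vsval X' by exact: linearP.
  rewrite mulmxDr mulmxDl mulmxDr mulmxDl -!scalemxAr -!scalemxAl -!scalemxAr -!scalemxAl.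
  by rewrite [LHS]mxE; congr (_ + _); rewrite mxE.
have hform_f : hform (w + 1) (fun Y => \det (S Y) * S Y i0 i1).
  by apply: hformM (hform_det _) (lS _ _).
have [D hD] := poly_chart_map Q.
exists (zeros (fun Y => \det (S Y) * S Y i0 i1)), D, (chart_map Q \o @r2v _ chart_dom).
split.
- exact: closed_zeros hform_f.
- have SY : S Y = symp w.
    have e : Q *m vsval Y *m Q^T = chart_mx 0.
      by rewrite YE !mulmxA hQ' mul1mx -mulmxA hQ' mulmx1.
    by rewrite /S e chart_mx_E'E' form0.
  move/(zerosP hform_f LY)/eqP; rewrite SY symp01 mulr1; exact/negP.
- exact: poly_map_r2v.
- move=> M [Y' [strY' MY']] nM.
  have : \det (S Y') * S Y' i0 i1 != 0.
    by apply/eqP => e; apply: nM; apply/(zerosP hform_f MY').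
  rewrite mulf_eq0 negb_or => /andP[dS S01].
  have [a [u [a0 Y'E]]] := chart_covers hQ strY' dS S01.
  by exists (v2r u); rewrite /= v2rK MY' Y'E line_scale.
Qed.

End OrbitChart.

(** * Families of square-zero matrices *)

(** Two points are joined by the image of a line, which misses 0 generically. *)
Lemma irreducible_image (K : numFieldType) (V : vectType K) (U : lmodType K) D (psi : U -> V) :
  poly_map D psi -> (exists u, psi u != 0) ->
  irreducible [set L : projspace V | exists u, val L = <[psi u]>%VS].
Proof.
move=> hpsi [u0 u00]; apply: (irreducible_curves _ hpsi (E := D)).
  by have [L Lu] := projspace_point u00; exists L, u0.
move=> L L' [u Lu] [u' Lu']; have [i ui] := exists_coord (span_neq0 Lu).
exists u, u', (fun x => coords (psi x) i); split=> // t ti; split=> [|M Mt].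
  by apply: contraNneq ti => ->; rewrite /coords linear0.
by eexists; exact: Mt.
Qed.

Section BaseLocus.
Context {R : realType} {n w : nat}.
Local Notation C := R[i].
Local Notation skewmx := (@Defs.skewmx R).
Variable E : 'M[C]_(w, n).
Hypotheses (isoE : isotropic E) (freeE : row_free E).

Definition hrefls N (M : 'M[C]_(N, n)) : 'M[C]_n :=
  foldr (fun i A => hrefl (row i M) *m A) 1%:M (enum 'I_N).

Lemma hrefls_conformal N (M : 'M[C]_(N, n)) :
  exists a, hrefls M *m (hrefls M)^T = a%:M.
Proof.
rewrite /hrefls; elim: (enum 'I_N) => [|i s [a e]] /=.
  by exists 1; rewrite trmx1 mulmx1.
exists (a * dot (row i M) (row i M) ^+ 2); rewrite trmx_mul mulmxA -[_ *m foldr _ _ _ *m _]mulmxA e.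
by rewrite mul_mx_scalar -scalemxAl tr_hrefl hrefl_sqr scale_scalar_mx.
Qed.

Lemma hrefls_refls N (vs : seq 'rV[C]_n) : anisotropic vs -> size vs = N ->
  exists (M : 'M[C]_(N, n)) a, a != 0 /\ hrefls M = a *: refls vs.
Proof.
move=> ani sz; pose M : 'M[C]_(N, n) := \matrix_(i < N) nth 0 vs i; exists M.
suff [a [a0 e]] : exists a, a != 0 /\ hrefls M = a *: refls [seq row i M | i <- enum 'I_N].
  exists a; split=> //; rewrite e; congr (_ *: refls _).
  apply: (@eq_from_nth _ 0); rewrite size_map size_enum_ord // => i iN.
  by rewrite (nth_map (Ordinal iN)) ?size_enum_ord // rowK nth_enum_ord.
rewrite /hrefls; elim: (enum 'I_N) => [|i s [a [a0 e]]] /=.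
  by exists 1; rewrite oner_neq0 scale1r.
have v0 : dot (row i M) (row i M) != 0.
  by rewrite rowK; apply: (allP ani); apply: mem_nth; rewrite sz.
exists (dot (row i M) (row i M) * a); rewrite mulf_neq0 //; split=> //.
by rewrite e [in LHS](hreflE v0) -scalemxAl -scalemxAr scalerA.
Qed.

Definition frame_dom N : lmodType C := ('M[C]_(N, n) * skewmx w)%type.

Definition frame_map N (p : frame_dom N) : skewmx n :=
  to_skew ((E *m hrefls p.1)^T *m vsval p.2 *m (E *m hrefls p.1)).

Lemma frame_map_val N (p : frame_dom N) :
  vsval (frame_map p) = (E *m hrefls p.1)^T *m vsval p.2 *m (E *m hrefls p.1).
Proof. exact/to_skewK/skew_sandwich/skew_val. Qed.

Lemma frame_isotropic N (M : 'M[C]_(N, n)) : isotropic (E *m hrefls M).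
Proof.
have [a e] := hrefls_conformal M.
rewrite /isotropic trmx_mul mulmxA -[E *m _ *m _]mulmxA e mul_mx_scalar -scalemxAl.
by rewrite isoE scaler0.
Qed.

Lemma poly_frame_map N : exists D, poly_map D (@frame_map N).
Proof.
have alg : fun_algebra (@poly_fun _ (frame_dom N)) := poly_fun_algebra.
have [cst add mul] := alg.
have hrow i : mx_fun poly_fun (fun p : frame_dom N => row i p.1).
  by move=> k j; apply: poly_fun_lin => a x y; rewrite !mxE.
have hh i : mx_fun poly_fun (fun p : frame_dom N => hrefl (row i p.1)).
  have hd : poly_fun (fun p : frame_dom N => dot (row i p.1) (row i p.1)).
    exact: (mx_funM alg (hrow i) (mx_funT (hrow i))).
  have := mx_funD alg (mx_funZ alg hd (mx_fun_const alg 1%:M))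
    (mx_funZ alg (cst (- 2)) (mx_funM alg (mx_funT (hrow i)) (hrow i))).
  congr mx_fun; apply/funext => p.
  by rewrite /hrefl scalemx1 scaleNr.
have hH : mx_fun poly_fun (fun p : frame_dom N => hrefls p.1).
  rewrite /hrefls; elim: (enum 'I_N) => [|i s IH] /=; first exact: (mx_fun_const alg).
  exact: (mx_funM alg (hh i) IH).
have hE := mx_funM alg (mx_fun_const alg E) hH.
have hS : mx_fun poly_fun (fun p : frame_dom N => vsval p.2).
  by move=> k j; apply: poly_fun_lin => a x y; rewrite !linearP !mxE.
have hM := mx_funM alg (mx_funM alg (mx_funT hE) hS) hE.
apply: poly_mapP => i; under eq_fun do rewrite (skew_functional _ (coords_scalar i)).
apply: (fun_algebra_sum alg) => j; apply: (fun_algebra_sum alg) => k.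
apply: mul (cst _).
by under eq_fun do rewrite frame_map_val; exact: hM.
Qed.

(** The row space of [frame_map p] lies in the image of that of [E] under a product
    of [N] reflections. Isotropic vectors are allowed in the product, where [hrefl]
    degenerates, in order to have a vector space of parameters. *)
Definition frame_points N : set (projspace (skewmx n)) :=
  [set L : projspace (skewmx n) | exists p : frame_dom N, val L = <[frame_map p]>%VS].

Lemma base_locusP (L : projspace (skewmx n)) (X : skewmx n) : val L = <[X]>%VS ->
  base_locus R n L <-> vsval X *m vsval X = 0.
Proof.
move=> LX; split=> [|XX Y]; first by apply; rewrite LX memv_line.
rewrite LX => /vlineP[a ->].
have -> : vsval (a *: X) = a *: vsval X by exact: linearZ.
by rewrite -scalemxAl -scalemxAr XX !scaler0.
Qed.

Lemma frame_points_sub N : frame_points N `<=` base_locus R n.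
Proof.
move=> L [p Lp]; apply/(base_locusP Lp); apply: isotropic_sqr0 (frame_map_val p).
exact: frame_isotropic.
Qed.

(** Missing reflections are supplied in pairs that cancel. *)
Lemma mem_frame_points N (L : projspace (skewmx n)) (X : skewmx n) vs (T : 'M[C]_w) :
  (0 < n)%N -> val L = <[X]>%VS -> anisotropic vs -> (size vs <= N)%N -> ~~ odd (N - size vs) ->
  T^T = - T -> vsval X = (E *m refls vs)^T *m T *m (E *m refls vs) ->
  frame_points N L.
Proof.
move=> n0 LX ani sz par hT XE.
pose e : 'rV[C]_n := delta_mx 0 (Ordinal n0).
have ee : dot e e = 1.
  by rewrite /dot trmx_delta mul_delta_mx mxE !eqxx.
have refle m : ~~ odd m -> refls (nseq m e) = 1%:M.
  elim/ltn_ind: m => -[|[|m]] IH //= om.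
  rewrite negbK in om; have := IH m (leqW (leqnn _)) om; rewrite /refls => ->.
  by rewrite mulmx1 refl_sqr // ee oner_neq0.
pose vs' := vs ++ nseq (N - size vs) e.
have ani' : anisotropic vs'.
  rewrite /anisotropic all_cat; apply/andP; split=> //.
  by apply/allP => v /nseqP[-> _]; rewrite ee oner_neq0.
have sz' : size vs' = N by rewrite size_cat size_nseq subnKC.
have vsE : refls vs' = refls vs by rewrite refls_cat refle // mulmx1.
have [M [a [a0 Me]]] := hrefls_refls ani' sz'.
exists (M, to_skew T).
have -> : frame_map (M, to_skew T) = a ^+ 2 *: X.
  apply: val_inj; rewrite -[LHS]/(vsval _) frame_map_val -[RHS]/(vsval _) linearZ /= to_skewK //.
  rewrite Me vsE XE -scalemxAr [(_ *: _)^T]linearZ /= -!scalemxAl -!scalemxAr scalerA.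
  by rewrite expr2.
by rewrite LX line_scale // expf_neq0.
Qed.

Hypothesis n_gt0 : (0 < n)%N.
Hypothesis w_max : forall X : 'M[C]_n, X^T = - X -> X *m X = 0 -> (\rank X <= w)%N.

Lemma base_locus_frame : base_locus R n = frame_points (2 * w) `|` frame_points (2 * w).+1.
Proof.
apply/seteqP; split=> [L BL|L [] /frame_points_sub //].
have [X X0 LX] := projspace_gen L; have XX := (base_locusP LX).1 BL.
have [vs [T [ani sz hT XE]]] := sqr0_frame isoE freeE (w_max (skew_val X) XX) (skew_val X) XX.
have [o|o] := boolP (odd (size vs)); [right|left];
  apply: (mem_frame_points n_gt0 LX ani _ _ hT XE); lia.
Qed.

(** A reflection fixing [E] makes up for the parity. *)
Lemma base_locus_frame_even (v : 'rV[C]_n) : dot v v != 0 -> E *m v^T = 0 ->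
  base_locus R n = frame_points (2 * w).
Proof.
move=> v0 Ev; apply/seteqP; split=> [L BL|L /frame_points_sub //].
have [X X0 LX] := projspace_gen L; have XX := (base_locusP LX).1 BL.
have [vs [T [ani sz hT XE]]] := sqr0_frame isoE freeE (w_max (skew_val X) XX) (skew_val X) XX.
have [o|o] := boolP (odd (size vs)); last first.
  by apply: (mem_frame_points n_gt0 LX ani _ _ hT XE); lia.
have Ev' : E *m refl v = E.
  rewrite /refl /hrefl -scalemxAr mulmxBr mul_mx_scalar -scalemxAr mulmxA Ev mul0mx scaler0.
  by rewrite subr0 scalerA mulVf // scale1r.
have XE' : vsval X = (E *m refls (v :: vs))^T *m T *m (E *m refls (v :: vs)).
  by rewrite /= [E *m (_ *m _)]mulmxA Ev'.
have ani' : anisotropic (v :: vs) by rewrite /= v0.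
by apply: (mem_frame_points n_gt0 LX ani' _ _ hT XE') => /=; move: (size vs) sz o => m; clear; lia.
Qed.

Lemma symp_point vs : ~~ odd w -> (0 < w)%N -> anisotropic vs ->
  exists (L : projspace (skewmx n)) (X : skewmx n), val L = <[X]>%VS /\
    vsval X = (E *m refls vs)^T *m symp w *m (E *m refls vs).
Proof.
move=> ow w0 ani; pose X := to_skew ((E *m refls vs)^T *m symp w *m (E *m refls vs)).
have XE : vsval X = (E *m refls vs)^T *m symp w *m (E *m refls vs).
  by apply/to_skewK/skew_sandwich/tr_symp.
have hQ := refls_orthogonal ani.
have str : stratum w (vsval X).
  rewrite XE; apply: symp_stratum => //; first exact: isotropic_mulr.
  have [G EG] := row_freeP freeE; apply/row_freeP; exists ((refls vs)^T *m G).
  by rewrite mulmxA -[E *m _ *m _]mulmxA hQ mulmx1.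
have X0 : X != 0.
  by apply: contraTneq (stratum_neq0 w0 str) => ->; rewrite linear0 eqxx.
by have [L LX] := projspace_point X0; exists L, X.
Qed.

Lemma frame_points_irreducible N : ~~ odd w -> (0 < w)%N -> irreducible (frame_points N).
Proof.
move=> ow w0; have [D hD] := poly_frame_map N; apply: irreducible_image hD _.
pose e : 'rV[C]_n := delta_mx 0 (Ordinal n_gt0).
have ani : anisotropic (nseq N e).
  apply/allP => v /nseqP[-> _].
  by rewrite /dot trmx_delta mul_delta_mx mxE !eqxx oner_neq0.
have [L [X [LX XE]]] := symp_point ow w0 ani.
have : frame_points N L.
  by apply: (mem_frame_points n_gt0 LX ani _ _ (tr_symp _) XE); rewrite size_nseq ?subnn.
by move=> [p Lp]; exists p; exact: span_neq0 Lp.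
Qed.

End BaseLocus.

(** * The two families of maximal isotropic subspaces *)

Section Rulings.
Context {R : realType} {m : nat}.
Local Notation C := R[i].
Local Notation skewmx := (@Defs.skewmx R).
Hypotheses (m_gt0 : (0 < m)%N) (m_even : ~~ odd m).

Definition half_frame : 'M[C]_(m, m + m) := row_mx 1%:M 'i%:M.

Lemma sqr_i : 'i * 'i = -1 :> C. Proof. by rewrite -expr2 sqrCi. Qed.

Lemma half_frame_isotropic : isotropic half_frame.
Proof.
rewrite /isotropic tr_row_mx trmx1 tr_scalar_mx mul_row_col mul1mx -scalar_mxM sqr_i.
by rewrite -raddfD subrr raddf0.
Qed.

Lemma half_frame_free : row_free half_frame.
Proof.
by apply/row_freeP; exists (col_mx 1%:M 0); rewrite mul_row_col mul1mx mulmx0 addr0.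
Qed.

(** For an isotropic frame [F], the minors of its two halves agree up to the sign
    [eta]; the minors of [F^T *m T *m F] detect it. *)
Definition sign_form (eta : C) (X : skewmx (m + m)) : C :=
  \det (ulsubmx (vsval X)) - eta * \det (ursubmx (vsval X)).

Lemma hform_sign eta : hform m (sign_form eta).
Proof.
have hl : hform m (fun X : skewmx (m + m) => \det (ulsubmx (vsval X))).
  by apply: hform_det => i j; apply: hform_lin => a X Y; rewrite !linearP !mxE.
have hr : hform m (fun X : skewmx (m + m) => \det (ursubmx (vsval X))).
  by apply: hform_det => i j; apply: hform_lin => a X Y; rewrite !linearP !mxE.
apply: hform_eq (hformD hl (hformZ (- eta) hr)) => X.
by rewrite mulNr.
Qed.

Lemma sign_form_frame eta (F : 'M[C]_(m, m + m)) (T : 'M[C]_m) X :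
  vsval X = F^T *m T *m F ->
  sign_form eta X =
    \det (lsubmx F) * \det T * (\det (lsubmx F) - eta * \det (rsubmx F)).
Proof.
move=> XE; rewrite /sign_form XE.
have -> : ulsubmx (F^T *m T *m F) = (lsubmx F)^T *m T *m lsubmx F.
  rewrite -{1 2}(hsubmxK F) tr_row_mx mul_col_mx mul_col_row.
  by rewrite block_mxKul.
have -> : ursubmx (F^T *m T *m F) = (lsubmx F)^T *m T *m rsubmx F.
  rewrite -{1 2}(hsubmxK F) tr_row_mx mul_col_mx mul_col_row.
  by rewrite block_mxKur.
by rewrite !det_mulmx det_tr; ring.
Qed.

Lemma isotropic_minors (F : 'M[C]_(m, m + m)) : isotropic F ->
  \det (lsubmx F) ^+ 2 = \det (rsubmx F) ^+ 2.
Proof.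
rewrite /isotropic -{1 2}(hsubmxK F) tr_row_mx mul_row_col => /eqP.
rewrite addr_eq0 => /eqP /(congr1 determinant).
rewrite -scaleN1r detZ !det_mulmx !det_tr -!expr2.
by rewrite -signr_odd (negbTE m_even) mul1r.
Qed.

Lemma frame_points_sign N :
  frame_points half_frame N `<=` zeros (sign_form 1) `|` zeros (sign_form (-1)).
Proof.
move=> L [p Lp].
have /isotropic_minors/eqP := frame_isotropic half_frame_isotropic p.1.
rewrite eqf_sqr => /orP[/eqP e|/eqP e]; [left|right]; apply/(zerosP (hform_sign _) Lp);
  by rewrite (sign_form_frame _ (frame_map_val half_frame p)) e; ring.
Qed.

(** An irreducible family has a constant sign, so one point decides. *)
Lemma frame_points_ruling N (L : projspace (skewmx (m + m))) X eta :
  eta ^+ 2 = 1 -> frame_points half_frame N L -> val L = <[X]>%VS ->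
  sign_form eta X != 0 -> frame_points half_frame N `<=` zeros (sign_form (- eta)).
Proof.
move=> eta2 NL LX nX.
have [_ irr] := frame_points_irreducible half_frame_isotropic half_frame_free
  (leq_trans m_gt0 (leq_addr m m)) N m_even m_gt0.
have [|h|h] := irr _ _ (closed_zeros (hform_sign eta)) (closed_zeros (hform_sign (- eta))) => //.
  move/eqP: eta2; rewrite sqrf_eq1.
  case/orP => /eqP ->; first exact: frame_points_sign.
  by rewrite opprK setUC; exact: frame_points_sign.
by case/negP: nX; apply/eqP/(zerosP (hform_sign eta) LX)/h.
Qed.

Definition flip : 'rV[C]_(m + m) := delta_mx 0 (lshift m (Ordinal m_gt0)).

Lemma flip_anisotropic : dot flip flip = 1.
Proof. by rewrite /dot trmx_delta mul_delta_mx mxE !eqxx. Qed.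

Lemma refl_flip : refl flip = 1%:M - 2 *: delta_mx (lshift m (Ordinal m_gt0)) (lshift m (Ordinal m_gt0)).
Proof.
by rewrite /refl /hrefl flip_anisotropic invr1 scale1r trmx_delta mul_delta_mx.
Qed.

Lemma mul_refl_flip (F : 'M[C]_(m, m + m)) a b (j := lshift m (Ordinal m_gt0)) :
  (F *m refl flip) a b = F a b - 2 * (F a j * (b == j)%:R).
Proof.
rewrite refl_flip mulmxBr mulmx1 -scalemxAr !mxE (bigD1 j) //= big1 ?addr0.
  by rewrite mxE eqxx.
by move=> k /negbTE kj; rewrite mxE kj mulr0.
Qed.

Lemma lsub_flip : \det (lsubmx (half_frame *m refl flip)) = -1.
Proof.
pose j := Ordinal m_gt0.
have -> : lsubmx (half_frame *m refl flip) = diag_mx (\row_i (if i == j then -1 else 1)).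
  apply/matrixP => a b; rewrite mxE mul_refl_flip !row_mxEl !mxE.
  rewrite (inj_eq (@lshift_inj _ _)).
  case: (eqVneq b j) => [->|bj]; last first.
    by rewrite !mulr0 subr0; case: eqP => // ->; rewrite (negbTE bj).
  by case: (eqVneq a j) => [_|_]; rewrite /= ?mulr1n ?mulr0n; ring.
rewrite det_diag (bigD1 j) //= big1 ?mulr1; last by move=> i /negbTE ij; rewrite mxE ij.
by rewrite mxE eqxx.
Qed.

Lemma rsub_flip : rsubmx (half_frame *m refl flip) = 'i%:M.
Proof.
apply/matrixP => a b; rewrite mxE mul_refl_flip row_mxEr.
by rewrite eq_rlshift !mulr0 subr0.
Qed.

Theorem base_locus_two_components :
  (forall X : 'M[C]_(m + m), X^T = - X -> X *m X = 0 -> (\rank X <= m)%N) ->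
  [set Z | irreducible_component (base_locus R (m + m)) Z] #= `I_2.
Proof.
move=> rk; have n0 : (0 < m + m)%N by rewrite addn_gt0 m_gt0.
have iso := half_frame_isotropic; have free := half_frame_free.
have irr N := frame_points_irreducible iso free n0 N m_even m_gt0.
(* The ratio of the two minors of [half_frame]. *)
pose eta : C := 'i ^+ m.
have eta2 : eta ^+ 2 = 1.
  by rewrite /eta -exprM mulnC exprM sqrCi -signr_odd (negbTE m_even).
have dS : \det (symp m : 'M[C]_m) != 0 by rewrite -unitfE -unitmxE symp_unit.
have two0 : (2 : C) != 0 by rewrite pnatr_eq0.
have ani0 : anisotropic [::] (n := m + m) (K := C) by [].
have [L0 [X0 [LX0 X0E]]] := symp_point iso free m_even m_gt0 ani0.
have ani1 : anisotropic [:: flip] by rewrite /= flip_anisotropic oner_neq0.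
have [L1 [X1 [LX1 X1E]]] := symp_point iso free m_even m_gt0 ani1.
have P0 : frame_points half_frame (2 * m) L0.
  by apply: (mem_frame_points n0 LX0 ani0 _ _ (tr_symp _) X0E); rewrite //= subn0 mul2n odd_double.
have P1 : frame_points half_frame (2 * m).+1 L1.
  by apply: (mem_frame_points n0 LX1 ani1 _ _ (tr_symp _) X1E); rewrite //= subn1 /= mul2n odd_double.
have n0' : sign_form (- eta) X0 != 0.
  rewrite (sign_form_frame _ X0E) /= mulmx1 row_mxKl row_mxKr det1 det_scalar -/eta.
  by rewrite mul1r mulf_neq0 // mulNr opprK -expr2 eta2.
have n1' : sign_form eta X1 != 0.
  rewrite (sign_form_frame _ X1E) /= mulmx1 lsub_flip rsub_flip det_scalar -/eta.
  rewrite mulf_neq0 ?mulf_neq0 ?oppr_eq0 ?oner_neq0 // -expr2 eta2 -opprD oppr_eq0.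
  exact: two0.
apply: (two_components (irr (2 * m)%N) (irr (2 * m).+1) _
  (closed_zeros (hform_sign eta)) (closed_zeros (hform_sign (- eta)))).
- exact: base_locus_frame.
- rewrite -[eta]opprK; apply: frame_points_ruling P0 LX0 n0'.
  by rewrite sqrrN.
- exact: frame_points_ruling P1 LX1 n1'.
- by move=> /(_ L0 P0)/(zerosP (hform_sign _) LX0)/eqP; apply/negP.
- by move=> /(_ L1 P1)/(zerosP (hform_sign _) LX1)/eqP; apply/negP.
Qed.

End Rulings.

(** * Orbits and the base locus *)

Section Orbits.
Context {R : realType} {n : nat}.
Local Notation C := R[i].
Local Notation skewmx := (@Defs.skewmx R).

Lemma orbit_stratum k : (4 * k <= n)%N ->
  orbit_of (Bmx R n k) = @stratum_points R n (2 * k)%N.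
Proof.
move=> kn; have hB := Bmx_stratum (R := R) kn.
apply/seteqP; split=> L.
  move=> [Q [X [hQ XE LX]]]; exists X; split=> //.
  by rewrite XE; exact: stratum_conj.
move=> [X [hX LX]]; have [Q hQ XE] := stratum_transitive hB hX.
by exists Q, X.
Qed.

Lemma base_locus_orbits : base_locus R n =
  \bigcup_(k in [set k : nat | (0 < k)%N /\ (4 * k <= n)%N]) orbit_of (Bmx R n k).
Proof.
apply/seteqP; split=> [L BL|L [k [k0 kn]]]; last first.
  rewrite orbit_stratum // => -[X [hX LX]].
  exact/(base_locusP LX)/stratum_sqr0/hX.
have [X X0 LX] := projspace_gen L; have XX := (base_locusP LX).1 BL.
have str := sqr0_stratum (skew_val X) XX.
have [even le] := stratum_parity str.
have rk : (\rank (vsval X) = 2 * (\rank (vsval X))./2)%N.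
  by rewrite mul2n even_halfK.
have rk0 : (0 < \rank (vsval X))%N.
  by rewrite lt0n mxrank_eq0; apply: contraNneq X0 => h; apply/eqP/val_inj.
move: str rk rk0 le; move: (\rank _) (_./2) => p k str pk p0 le.
have kn : (4 * k <= n)%N by lia.
exists k; first by split=> //=; lia.
by rewrite orbit_stratum //; exists X; rewrite -pk.
Qed.

Lemma rank_max (X : 'M[C]_n) : X^T = - X -> X *m X = 0 -> (\rank X <= 2 * (n %/ 4))%N.
Proof. by move=> hX XX; have [] := stratum_parity (sqr0_stratum hX XX); move: (\rank X) => p; clear; lia. Qed.

End Orbits.

Lemma bin2_sqr n : ('C(n, 2) * 2 + n = n * n)%N.
Proof.
elim: n => // n IH; rewrite binS bin1 mulnDl addnAC.
move: IH; set x := 'C(n, 2); nia.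
Qed.

(** The orbit dimension and the claimed codimension add up to the dimension of
    the projective space of skew-symmetric matrices. *)
Lemma codimension_count k r : (0 < k)%N ->
  ('C(2 * k, 2).-1 + 'C(2 * k, 2) + 2 * k * r + (4 * k ^ 2 + 2 * k * r + 'C(r, 2)) =
   'C(4 * k + r, 2).-1)%N.
Proof.
move=> k0; have h1 := bin2_sqr (2 * k); have h2 := bin2_sqr r.
have h3 := bin2_sqr (4 * k + r).
have : (0 < 'C(2 * k, 2))%N by rewrite bin_gt0; lia.
move: h1 h2 h3; set x := 'C(_, 2); set y := 'C(_, 2); set z := 'C(_, 2).
rewrite -mulnn; nia.
Qed.

Local Open Scope nat_scope.

Theorem theorem2p9 (R : realType) (n : nat) :
  [/\ forall k r : nat, 0 < k -> n = 4 * k + r ->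
        codimension (orbit_of (Bmx R n k)) (4 * k ^ 2 + 2 * k * r + 'C(r, 2)),
      base_locus R n =
        \bigcup_(k in [set k : nat | 0 < k /\ 4 * k <= n]) orbit_of (Bmx R n k),
      0 < n -> 4 %| n ->
        [set Z | irreducible_component (base_locus R n) Z] #= `I_2
    & 4 <= n -> ~~ (4 %| n) -> irreducible (base_locus R n)].
Proof.
split=> [k r k0 nkr||n0 n4|n4 nd].
- have w2 : (1 < 2 * k)%N by lia.
  have [E [E' [Z basis]]] := @witt_basis_exists R[i] (2 * k) r n ltac:(lia).
  pose i0 := Ordinal (ltnW w2); pose i1 := Ordinal w2.
  have ow : ~~ odd (2 * k) by rewrite mul2n odd_double.
  have s01 : (symp (2 * k) : 'M[R[i]]_(2 * k)) i0 i1 = 1%R by rewrite mxE /= subr0.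
  exists (dim (chart_dom (R := R) (r := r) i0 i1)).
    rewrite orbit_stratum; last by lia.
    exact: krull_dim_stratum basis ow s01.
  rewrite (dim_chart_dom s01) codimension_count // -nkr -(dim_skewmx (R := R)) -dimvf.
  apply: krull_dim_projspace; rewrite dimvf dim_skewmx bin_gt0; lia.
- exact: base_locus_orbits.
- have nE : n = 2 * (n %/ 4) + 2 * (n %/ 4) by lia.
  have rk := @rank_max R n; have m0 : 0 < 2 * (n %/ 4) by lia.
  have om : ~~ odd (2 * (n %/ 4)) by rewrite mul2n odd_double.
  move: nE rk m0 om; move: (2 * (n %/ 4)) => m nE; subst n => rk m0 om.
  exact: base_locus_two_components.
- have [E [E' [Z [[iso _ EE' ZZ] [EZ _ _]]]]] :=
    @witt_basis_exists R[i] (2 * (n %/ 4)) (n %% 4) n ltac:(lia).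
  have free : row_free E by apply/row_freeP; exists E'^T%R.
  have r0 : 0 < n %% 4 by lia.
  pose v := row (Ordinal r0) Z.
  have vv : dot v v = 1%R by rewrite dot_row ZZ mxE eqxx.
  have Ev : E *m v^T%R = 0%R by rewrite /v tr_row colE mulmxA EZ mul0mx.
  rewrite (base_locus_frame_even iso free _ (@rank_max R n) _ Ev) ?vv ?oner_neq0 //; last by lia.
  apply: frame_points_irreducible => //; lia.
Qed.
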